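(* Let $F$ be a field of arbitrary characteristic. The free $\Gamma$-algebra $\Gamma=\Gamma[t_1,\dots,t_m;v_1,\dots,v_n]$ over $F$ on even generators $t_1,\dots,t_m$ and odd generators $v_1,\dots,v_n$ has the following structure: $$\Gamma_0=F\langle t_1,\dots,t_m\rangle+ S_n'\otimes F[\bar t_1,\dots,\bar t_m],\qquad \Gamma_1=F[\bar t_1,\dots,\bar t_m]\otimes\Big(\bigoplus_{j=1}^nB_{n,j}V_j\Big),$$ where $F\langle t_1,\dots,t_m\rangle$ and $F[\bar t_1,\dots,\bar t_m]$ are the free associative and the polynomial algebras on $m$ variables, $S_n'$ is the augmentation ideal of the algebra $S_n$, $v_i\cdot v_j=\alpha_{ij}\in S_n$, $V_i=Fv_i$, and for any $f=f(t_1,\dots,t_m)\in F\langle t_1,\dots,t_m\rangle$ and $v\in\Gamma_1$ one has $f\cdot v=f(\bar t_1,\dots,\bar t_m)\otimes v$ (i.e. $f$ acts by multiplication by its image $f(\bar t_1,\dots,\bar t_m)$ in the factor $F[\bar t_1,\dots,\bar t_m]$).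
   Context: Algebras are not assumed associative; $[a,b]=ab-ba$, $(a,b,c)=(ab)c-a(bc)$, and $Z(\cdot)$ denotes the center. A $\Gamma$-algebra is a $\mathbb Z_2$-graded $F$-algebra $\Gamma=\Gamma_0\oplus\Gamma_1$ such that: (i) $\Gamma_0$ is a unital associative algebra (whose identity is the identity of $\Gamma$), $[\Gamma_0,\Gamma_1]=0$ and $(\Gamma_0,\Gamma,\Gamma)=0$ (associators whose first entry is in $\Gamma_0$ vanish); (ii) $\Gamma_1^2\subseteq Z(\Gamma_0)$; (iii) $xy+yx=0$ for $x,y\in\Gamma_1$; (iv) $(xy)z+(yz)x+(zx)y=0$ for $x,y,z\in\Gamma_1$. The free $\Gamma$-algebra on even generators $t_i$ and odd generators $v_j$ is defined by the usual universal property: any assignment of the $t_i$ to even elements and of the $v_j$ to odd elements of a $\Gamma$-algebra extends uniquely to a unital grading-preserving homomorphism. Let $A_n=F[x_1,\dots,x_n;y_1,\dots,y_n]$, and let $\Gamma(A_n)=A_n\oplus A_n^2$ be the $\Gamma$-algebra with even part $A_n$, odd part $A_n^2$, and products extending that of $A_n$ by $a\cdot(b,c)=(b,c)\cdot a=(ab,ac)$, $(a,b)\cdot(c,d)=ad-bc$. In it put $v_i=(x_i,y_i)$, $V_i=Fv_i$, $V=\sum_iV_i$, $\alpha_{ij}=v_iv_j=x_iy_j-x_jy_i$, $S_n=F[\alpha_{ij}\mid1\le i<j\le n]\subset A_n$; $S_n'$ is the ideal of $S_n$ of polynomials in the $\alpha_{ij}$ without scalar term. $B_n=\{\alpha_{i_1j_1}\cdots\alpha_{i_rj_r}\mid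 r\ge0,\ i_1\le\cdots\le i_r,\ j_1\le\cdots\le j_r,\ i_s<j_s\}$ (including $1$), $B_{n,m}=\{\alpha_{i_1j_1}\cdots\alpha_{i_rj_r}\in B_n\mid j_1\ge m\}$ (including $1$), and $B_{n,j}V_j$ denotes the $F$-span of the elements $bv_j$, $b\in B_{n,j}$; the sum $\bigoplus_jB_{n,j}V_j$ is $S_nV\subseteq A_n^2$. The multiplication in the described algebra: $F\langle t_1,\dots,t_m\rangle$ is a subalgebra; $(S_n'\otimes F[\bar t_1,\dots,\bar t_m])\oplus\Gamma_1$ is an ideal with the product inherited from $F[\bar t_1,\dots,\bar t_m]\otimes\Gamma(A_n)$; and $f\in F\langle t_1,\dots,t_m\rangle$ acts on this ideal, on both sides, by multiplication by $f(\bar t_1,\dots,\bar t_m)$. The sum in $\Gamma_0$ is a direct sum of vector spaces.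
   Formalization: In characteristic 2, condition (iii) in the definition of a Γ-algebra is strengthened by requiring x·x = 0 for all odd x; with xy+yx=0 alone the claim fails there for n ≥ 1, since v_1·v_1 = α_11 = 0 need not hold. *)

(* Defs.v *)
From HB Require Import structures.
From mathcomp Require Import all_boot all_order all_algebra.
From mathcomp Require Import boolp.
From mathcomp Require Import monalg mpoly.

Set Implicit Arguments.
Unset Strict Implicit.
Unset Printing Implicit Defensive.

Import GRing.Theory.
Local Open Scope ring_scope.

Record superalg (F : fieldType) := Superalg {
  sa_car :> lmodType F;
  sa_mul : sa_car -> sa_car -> sa_car;
  sa_one : sa_car;
  sa_even : {pred sa_car};
  sa_odd : {pred sa_car} }.

Section Superalg.
Variables (F : fieldType) (G : superalg F).

Local Notation "x ** y" := (@sa_mul F G x y) (at level 40, left associativity).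
Local Notation G0 := (@sa_even F G).
Local Notation G1 := (@sa_odd F G).

Definition sa_comm (x y : G) : G := x ** y - y ** x.
Definition sa_assoc (x y z : G) : G := (x ** y) ** z - x ** (y ** z).

Record is_superalg : Prop := IsSuperalg {
  sa_linl : forall y, linear (fun x => x ** y);
  sa_linr : forall x, linear (fun y => x ** y);
  sa_sub0 : submod_closed G0;
  sa_sub1 : submod_closed G1;
  sa_decomp : forall x, exists y z, [/\ y \in G0, z \in G1 & x = y + z];
  sa_disj : forall x, x \in G0 -> x \in G1 -> x = 0;
  sa_00 : forall x y, x \in G0 -> y \in G0 -> x ** y \in G0;
  sa_01 : forall x y, x \in G0 -> y \in G1 -> x ** y \in G1;
  sa_10 : forall x y, x \in G1 -> y \in G0 -> x ** y \in G1;
  sa_11 : forall x y, x \in G1 -> y \in G1 -> x ** y \in G0 }.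

Record in_even_center (z : G) : Prop := InEvenCenter {
  ec_even : z \in G0;
  ec_comm : forall a, a \in G0 -> sa_comm z a = 0;
  ec_assoc : forall a b, a \in G0 -> b \in G0 ->
    [/\ sa_assoc z a b = 0, sa_assoc a z b = 0 & sa_assoc a b z = 0] }.

(** The two fields [ga_skew] and [ga_alt] together say that the product of odd
    elements is alternating. Outside characteristic 2, [ga_alt] is vacuous. In
    characteristic 2 it does not follow from [ga_skew] (take [F + Fa + Fv] with
    [a] even, [v] odd, [vv = a] and [aa = av = va = 0]), and without it the
    square of a free odd generator would not vanish, contrary to
    [alpha_ii = 0]. *)
Record is_gamma_alg : Prop := IsGammaAlg {
  ga_super : is_superalg;
  ga_one_even : sa_one G \in G0;
  ga_one : forall x, sa_one G ** x = x /\ x ** sa_one G = x;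
  ga_assoc0 : forall a b c, a \in G0 -> b \in G0 -> c \in G0 ->
    sa_assoc a b c = 0;
  ga_comm01 : forall a x, a \in G0 -> x \in G1 -> sa_comm a x = 0;
  ga_assoc : forall a x y, a \in G0 -> sa_assoc a x y = 0;
  ga_center : forall x y, x \in G1 -> y \in G1 -> in_even_center (x ** y);
  ga_skew : forall x y, x \in G1 -> y \in G1 -> x ** y + y ** x = 0;
  ga_alt : 2%N \in [pchar F] -> forall x, x \in G1 -> x ** x = 0;
  ga_cyc : forall x y z, x \in G1 -> y \in G1 -> z \in G1 ->
    (x ** y) ** z + (y ** z) ** x + (z ** x) ** y = 0 }.

End Superalg.

Record is_superalg_hom (F : fieldType) (G H : superalg F) (f : G -> H) : Prop :=
  IsSuperalgHom {
    sh_lin : linear f;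
    sh_one : f (sa_one G) = sa_one H;
    sh_mul : forall x y, f (sa_mul x y) = sa_mul (f x) (f y);
    sh_even : forall x, x \in @sa_even F G -> f x \in @sa_even F H;
    sh_odd : forall x, x \in @sa_odd F G -> f x \in @sa_odd F H }.

Record is_free_gamma_alg (F : fieldType) (m n : nat) (G : superalg F)
    (t : 'I_m -> G) (v : 'I_n -> G) : Prop := IsFreeGammaAlg {
  fg_gamma : is_gamma_alg G;
  fg_even : forall i, t i \in @sa_even F G;
  fg_odd : forall j, v j \in @sa_odd F G;
  fg_univ : forall (H : superalg F) (a : 'I_m -> H) (b : 'I_n -> H),
    is_gamma_alg H ->
    (forall i, a i \in @sa_even F H) -> (forall j, b j \in @sa_odd F H) ->
    exists f : G -> H,
      [/\ is_superalg_hom f, f \o t =1 a, f \o v =1 b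
        & forall g : G -> H, is_superalg_hom g -> g \o t =1 a -> g \o v =1 b ->
            g =1 f] }.

Inductive lspan (F : fieldType) (V : lmodType F) (X : V -> Prop) : V -> Prop :=
| lspan0 : lspan X 0
| lspanS c x v : X x -> lspan X v -> lspan X (c *: x + v).

Section LspanTheory.
Variables (F : fieldType).
Implicit Types (V W : lmodType F).

Lemma lspan_mem V (X : V -> Prop) x : X x -> lspan X x.
Proof. by move=> Xx; rewrite -[x]addr0 -[x]scale1r; apply: lspanS (lspan0 _). Qed.

Lemma lspanD V (X : V -> Prop) u v : lspan X u -> lspan X v -> lspan X (u + v).
Proof.
by elim=> [|c x w Xx _ IH] Xv; rewrite ?add0r // -addrA; apply: lspanS => //; apply: IH.
Qed.

Lemma lspanZ V (X : V -> Prop) a u : lspan X u -> lspan X (a *: u).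
Proof.
elim=> [|c x w Xx _ IH]; first by rewrite scaler0; apply: lspan0.
by rewrite scalerDr scalerA; apply: lspanS.
Qed.

Lemma lspan_sum V (X : V -> Prop) (I : Type) (r : seq I) (u : I -> V) :
  (forall i, lspan X (u i)) -> lspan X (\sum_(i <- r) u i).
Proof.
move=> Xu; elim: r => [|i r IH]; first by rewrite big_nil; apply: lspan0.
by rewrite big_cons; apply: lspanD.
Qed.

Lemma lspan_map V W (X : V -> Prop) (Y : W -> Prop) (f : V -> W) u :
  linear f -> (forall x, X x -> lspan Y (f x)) -> lspan X u -> lspan Y (f u).
Proof.
move=> fl XY; have f0 : f 0 = 0.
  by have := fl (-1) 0 0; rewrite scaler0 addr0 scaleN1r addNr.
elim=> [|c x v Xx _ IH]; first by rewrite f0; apply: lspan0.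
by rewrite fl; apply: lspanD => //; apply/lspanZ/XY.
Qed.

Lemma lspan_bil V1 V2 W (X : V1 -> Prop) (Y : V2 -> Prop) (Z : W -> Prop)
    (f : V1 -> V2 -> W) u v :
  (forall y, linear (f^~ y)) -> (forall x, linear (f x)) ->
  (forall x y, X x -> Y y -> lspan Z (f x y)) ->
  lspan X u -> lspan Y v -> lspan Z (f u v).
Proof.
move=> fl fr XYZ Xu Yv.
apply: (lspan_map (f := f^~ v) (fl v) _ Xu) => x Xx.
by apply: (lspan_map (f := f x) (fr x) _ Yv) => y Yy; apply: XYZ.
Qed.

End LspanTheory.

Definition is_direct_sum (F : fieldType) (V : lmodType F) (I : finType)
    (U : I -> V -> Prop) (W : V -> Prop) : Prop :=
  (forall w : {ffun I -> V}, (forall i, U i (w i)) -> W (\sum_i w i)) /\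
  (forall u, W u ->
     exists! w : {ffun I -> V}, (forall i, U i (w i)) /\ u = \sum_i w i).

(** The products [a . u] and [u . w] of [Gamma(A) = A (+) A^2], for [a] in [A]
    and [u], [w] in [A^2]. *)

Definition scal2 (A : comNzRingType) (a : A) (u : A * A) : A * A :=
  (a * u.1, a * u.2).
Definition det2 (A : comNzRingType) (u w : A * A) : A := u.1 * w.2 - u.2 * w.1.

Lemma det2_scal2 (A : comNzRingType) (a b : A) (u w : A * A) :
  det2 (scal2 a u) (scal2 b w) = a * b * det2 u w.
Proof. by rewrite /det2 /= mulrBr ![a * _ * (b * _)]mulrACA. Qed.

Section Alpha.
Variables (F : fieldType) (n : nat).

(** [A_n], with [x_i = 'X_(lshift n i)] and [y_i = 'X_(rshift n i)]. *)
Definition An := {mpoly F[n + n]}.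
HB.instance Definition _ := GRing.ComAlgebra.on An.

Definition vv (i : 'I_n) : An * An := ('X_(lshift n i), 'X_(rshift n i)).
Definition alpha (i j : 'I_n) : An := det2 (vv i) (vv j).

(** Products of generators [alpha_ij] are indexed by lists of pairs [(i, j)];
    [S_n], [S_n'] and the [B_{n,k}] use pairs with [i < j] only. *)
Definition amon (s : seq ('I_n * 'I_n)) : An := \prod_(p <- s) alpha p.1 p.2.
Definition ltpairs (s : seq ('I_n * 'I_n)) : bool :=
  all (fun p : 'I_n * 'I_n => p.1 < p.2)%N s.

Definition Sn : An -> Prop :=
  lspan (fun a => exists2 s, ltpairs s & a = amon s).
Definition Sn' : An -> Prop :=
  lspan (fun a => exists2 s, ltpairs s && (s != [::]) & a = amon s).
Definition SnV : An * An -> Prop :=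
  lspan (fun u => exists2 a, Sn a & exists j, u = scal2 a (vv j)).

Definition standard (s : seq ('I_n * 'I_n)) : bool :=
  ltpairs s &&
  sorted (fun p q : 'I_n * 'I_n => (p.1 <= q.1) && (p.2 <= q.2))%N s.

(** [Bn k] is [B_{n,k}]: the condition [j_1 >= k] bears on the head of the list,
    and the empty product is allowed. *)
Definition Bn (k : 'I_n) (b : An) : Prop :=
  exists2 s, standard s && (if s is p :: _ then (k <= p.2)%N else true)
           & b = amon s.
Definition BnV (j : 'I_n) : An * An -> Prop :=
  lspan (fun u => exists2 b, Bn j b & u = scal2 b (vv j)).

Lemma amon_cat s t : amon (s ++ t) = amon s * amon t.
Proof. exact: big_cat. Qed.

Lemma alphaii i : alpha i i = 0.
Proof. by rewrite /alpha /det2 [X in X - _]mulrC subrr. Qed.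

Lemma alphaC i j : alpha i j = - alpha j i.
Proof.
by rewrite /alpha /det2 opprB [X in X - _]mulrC [X in _ - X]mulrC.
Qed.

Lemma Sn1 : Sn 1.
Proof. by apply: lspan_mem; exists [::]; rewrite // /amon big_nil. Qed.

Lemma Sn'_sub a : Sn' a -> Sn a.
Proof.
apply: (lspan_map (f := id)) => // _ [s /andP[ls _] ->].
by apply: lspan_mem; exists s.
Qed.

Lemma mul_linl (A : comAlgType F) (y : A) : linear (fun x : A => x * y).
Proof. by move=> c a b; rewrite mulrDl scalerAl. Qed.

Lemma mul_linr (A : comAlgType F) (x : A) : linear (fun y : A => x * y).
Proof. by move=> c a b; rewrite mulrDr scalerAr. Qed.

Lemma SnM a b : Sn a -> Sn b -> Sn (a * b).
Proof.
apply: (lspan_bil (@mul_linl An) (@mul_linr An)).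
move=> _ _ [s ls ->] [t lt ->]; apply: lspan_mem.
by exists (s ++ t); rewrite ?amon_cat // /ltpairs all_cat; apply/andP.
Qed.

Lemma SnM' a b : Sn a -> Sn' b -> Sn' (a * b).
Proof.
apply: (lspan_bil (@mul_linl An) (@mul_linr An)).
move=> _ _ [s ls ->] [t /andP[lt tN] ->]; apply: lspan_mem.
exists (s ++ t); rewrite ?amon_cat // /ltpairs all_cat.
by apply/andP; split; [apply/andP | case: s {ls}].
Qed.

Lemma Sn'_alpha i j : Sn' (alpha i j).
Proof.
have lt_alpha (k l : 'I_n) : (k < l)%N -> Sn' (alpha k l).
  move=> lt_kl; apply: lspan_mem; exists [:: (k, l)].
    by rewrite /ltpairs /= lt_kl.
  by rewrite /amon big_seq1.
have [/lt_alpha//|/lt_alpha Sji|/val_inj->] := ltngtP i j.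
  by rewrite alphaC -scaleN1r; apply: lspanZ.
by rewrite alphaii; apply: lspan0.
Qed.

Lemma scal2_linl u : linear (fun a : An => scal2 a u).
Proof.
by move=> c a b; congr pair => /=; rewrite mulrDl scalerAl.
Qed.

Lemma scal2_linr (a : An) : linear (scal2 a).
Proof.
by move=> c u w; congr pair => /=; rewrite mulrDr scalerAr.
Qed.

Lemma det2_linr (u : An * An) : linear (det2 u).
Proof.
move=> c w z; rewrite /det2 /= !mulrDr -!scalerAr opprD addrACA.
by rewrite scalerBr.
Qed.

Lemma det2C (u w : An * An) : det2 u w = - det2 w u.
Proof. by rewrite /det2 opprB [X in X - _]mulrC [X in _ - X]mulrC. Qed.

Lemma det2_linl (w : An * An) : linear (fun u => det2 u w).
Proof.
by move=> c u z; rewrite ![det2 _ w]det2C det2_linr opprD scalerN.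
Qed.

Lemma SnVM a u : Sn a -> SnV u -> SnV (scal2 a u).
Proof.
move=> Sa; apply: (lspan_map (@scal2_linr a)) => _ [b Sb [j ->]].
apply: lspan_mem; exists (a * b); first exact: SnM.
by exists j; rewrite /scal2 /= !mulrA.
Qed.

Lemma SnV_det2 u w : SnV u -> SnV w -> Sn' (det2 u w).
Proof.
apply: (lspan_bil det2_linl det2_linr) => _ _ [a Sa [i ->]] [b Sb [j ->]].
have -> : det2 (scal2 a (vv i)) (scal2 b (vv j)) = (a * b) * alpha i j.
  exact: det2_scal2.
by apply: SnM' (Sn'_alpha _ _); apply: SnM.
Qed.

Lemma SnV_vv i : SnV (vv i).
Proof.
apply: lspan_mem; exists 1; first exact: Sn1.
by exists i; rewrite /scal2 !mul1r -surjective_pairing.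
Qed.

End Alpha.

Section Tensor.
Variables (F : fieldType) (m n : nat).
Local Notation A := (An F n).

(** [F[tbar] (x) A_n] is [A_n[tbar_1, ..., tbar_m]], seen as an [F]-algebra; for
    a subspace [W] of [A_n], [F[tbar] (x) W] is the set of the polynomials in
    the [tbar_i] all of whose coefficients lie in [W], and similarly for
    subspaces of [A_n^2]. *)
Definition TA := {mpoly A[m]}.
HB.instance Definition _ := GRing.ComNzRing.on TA.

Definition TAscale (c : F) (p : TA) : TA := (c%:MP : A)%:MP * p.

Fact TAscaleA a b p : TAscale a (TAscale b p) = TAscale (a * b) p.
Proof. by rewrite /TAscale mulrA -!mpolyCM. Qed.
Fact TAscale1 : left_id 1 TAscale.
Proof. by move=> p; rewrite /TAscale !mpolyC1 mul1r. Qed.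
Fact TAscaleDr : right_distributive TAscale +%R.
Proof. by move=> a p q; rewrite /TAscale mulrDr. Qed.
Fact TAscaleDl p : {morph TAscale^~ p : a b / a + b}.
Proof. by move=> a b; rewrite /TAscale !mpolyCD mulrDl. Qed.
HB.instance Definition _ := GRing.Zmodule_isLmodule.Build F TA
  TAscaleA TAscale1 TAscaleDr TAscaleDl.
Fact TAscaleAl (a : F) (p q : TA) : a *: (p * q) = (a *: p) * q.
Proof. by rewrite /GRing.scale /= /TAscale mulrA. Qed.
HB.instance Definition _ := GRing.Lmodule_isLalgebra.Build F TA TAscaleAl.
HB.instance Definition _ := GRing.Lalgebra_isComAlgebra.Build F TA.

Definition tens (W : A -> Prop) : {pred TA} :=
  fun p => `[< forall k, W p@_k >].
Definition tens2 (W : A * A -> Prop) : {pred TA * TA} :=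
  fun u => `[< forall k, W (u.1@_k, u.2@_k) >].

Fact mcoeffTAZ c (p : TA) k : (c *: p)@_k = c *: p@_k.
Proof.
by rewrite [c *: p]/(_ * p) mcoeffCM mul_mpolyC.
Qed.

Fact tens_submod (X : A -> Prop) : submod_closed (tens (lspan X)).
Proof.
split=> [|c p q /asboolP Xp /asboolP Xq]; apply/asboolP => k.
  by rewrite mcoeff0; apply: lspan0.
by rewrite mcoeffD mcoeffTAZ; apply: lspanD => //; apply: lspanZ.
Qed.

Fact tens2_submod (X : A * A -> Prop) : submod_closed (tens2 (lspan X)).
Proof.
split=> [|c p q /asboolP Xp /asboolP Xq]; apply/asboolP => k.
  by rewrite !mcoeff0; apply: lspan0.
have -> : ((c *: p + q).1@_k, (c *: p + q).2@_k)
   = c *: (p.1@_k, p.2@_k) + (q.1@_k, q.2@_k).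
  by congr pair => /=; rewrite mcoeffD mcoeffTAZ.
by apply: lspanD => //; apply: lspanZ.
Qed.

(** [f(t_1, ..., t_m) |-> f(tbar_1, ..., tbar_m)] on the free associative
    algebra. *)
Definition freeT := {malg F[{fmonom 'I_m}]}.
HB.instance Definition _ := GRing.Lalgebra.on freeT.
Definition bar (f : freeT) : TA :=
  monalg.mmap (in_alg TA) (fun w => \prod_(i <- fmonom_val w) ('X_i : TA)) f.

Fact tensM (P Q X : A -> Prop) (p q : TA) :
  (forall a b, P a -> Q b -> lspan X (a * b)) ->
  p \in tens P -> q \in tens Q -> p * q \in tens (lspan X).
Proof.
move=> PQ /asboolP Pp /asboolP Qq; apply/asboolP => k.
by rewrite mcoeffM -big_filter; apply: lspan_sum => i; apply: PQ.
Qed.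

Fact tens2M (P : A -> Prop) (Q X : A * A -> Prop) (p : TA) (u : TA * TA) :
  (forall a b, P a -> Q b -> lspan X (scal2 a b)) ->
  p \in tens P -> u \in tens2 Q -> scal2 p u \in tens2 (lspan X).
Proof.
move=> PQ /asboolP Pp /asboolP Qu; apply/asboolP => k.
pose c i := (u.1@_i, u.2@_i).
have -> : ((scal2 p u).1@_k, (scal2 p u).2@_k) =
  \sum_(i : 'X_{1..m < (mdeg k).+1, (mdeg k).+1} | k == (i.1 + i.2)%MM)
    scal2 p@_i.1 (c i.2).
  rewrite [RHS]surjective_pairing (raddf_sum fst) (raddf_sum snd).
  by congr pair; rewrite mcoeffM.
rewrite -big_filter; apply: lspan_sum => i.
exact: PQ (Pp _) (Qu _).
Qed.

Fact tens_det2 (P Q : A * A -> Prop) (X : A -> Prop) (u w : TA * TA) :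
  (forall a b, P a -> Q b -> lspan X (det2 a b)) ->
  u \in tens2 P -> w \in tens2 Q -> det2 u w \in tens (lspan X).
Proof.
move=> PQ /asboolP Pu /asboolP Qw; apply/asboolP => k.
rewrite /det2 mcoeffB !mcoeffM -sumrB -big_filter.
apply: lspan_sum => i; exact: PQ (Pu i.1) (Qw i.2).
Qed.

Fact tens_Sn_bar f : bar f \in tens (@Sn F n).
Proof.
have SX : submod_closed (tens (@Sn F n)) := tens_submod _.
have [S0 SL] := SX.
have SM p q : p \in tens (@Sn F n) -> q \in tens (@Sn F n) ->
  p * q \in tens (@Sn F n) by apply: tensM => a b; apply: SnM.
have SU k : 'X_[k] \in tens (@Sn F n).
  apply/asboolP => l; rewrite mcoeffX.
  by case: eqP => _; [apply: Sn1 | apply: lspan0].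
have S1 : 1 \in tens (@Sn F n) by rewrite -mpolyX0.
rewrite /bar monalg.mmapE; apply: (big_ind (fun p => p \in tens (@Sn F n))).
- exact: S0.
- by move=> p q Sp Sq; rewrite -[p]scale1r; apply: SL.
move=> w _; apply: (SM _ _); first by rewrite -[in_alg _ _]addr0; apply: SL.
by apply: (big_ind (fun p => p \in tens (@Sn F n))) => [||i _]; [apply: S1 | apply: SM | apply: SU].
Qed.

(** [evI] is [S_n' (x) F[tbar]] and [oddG] is [F[tbar] (x) S_n V]. *)
Definition evI_pred : {pred TA} := tens (@Sn' F n).
HB.instance Definition _ :=
  GRing.isSubmodClosed.Build F TA evI_pred (tens_submod _).
Record evI := EvI { evI_val :> TA; _ : evI_val \in evI_pred }.
HB.instance Definition _ := [isSub for evI_val].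
HB.instance Definition _ := [Choice of evI by <:].
HB.instance Definition _ := [SubChoice_isSubLmodule of evI by <:].

Definition oddG_pred : {pred TA * TA} := tens2 (@SnV F n).
HB.instance Definition _ :=
  GRing.isSubmodClosed.Build F (TA * TA)%type oddG_pred (tens2_submod _).
Record oddG := OddG { oddG_val :> TA * TA; _ : oddG_val \in oddG_pred }.
HB.instance Definition _ := [isSub for oddG_val].
HB.instance Definition _ := [Choice of oddG by <:].
HB.instance Definition _ := [SubChoice_isSubLmodule of oddG by <:].

Fact evI_mulP (p q : evI) : evI_val p * evI_val q \in evI_pred.
Proof.
by apply: tensM (valP p) (valP q) => a b /Sn'_sub; apply: SnM'.
Qed.
Definition evI_mul (p q : evI) : evI := EvI (evI_mulP p q).

Fact evI_actP (f : freeT) (p : evI) : bar f * evI_val p \in evI_pred.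
Proof. by apply: tensM (tens_Sn_bar f) (valP p) => a b; apply: SnM'. Qed.
Definition evI_act (f : freeT) (p : evI) : evI := EvI (evI_actP f p).

Fact oddG_mulP (p : evI) (u : oddG) : scal2 (evI_val p) (oddG_val u) \in oddG_pred.
Proof.
by apply: tens2M (valP p) (valP u) => a b /Sn'_sub; apply: SnVM.
Qed.
Definition oddG_mul (p : evI) (u : oddG) : oddG := OddG (oddG_mulP p u).

Fact oddG_actP (f : freeT) (u : oddG) : scal2 (bar f) (oddG_val u) \in oddG_pred.
Proof. by apply: tens2M (tens_Sn_bar f) (valP u) => a b; apply: SnVM. Qed.
Definition oddG_act (f : freeT) (u : oddG) : oddG := OddG (oddG_actP f u).

Fact oddG_detP (u w : oddG) : det2 (oddG_val u) (oddG_val w) \in evI_pred.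
Proof. by apply: tens_det2 (valP u) (valP w) => a b; apply: SnV_det2. Qed.
Definition oddG_det (u w : oddG) : evI := EvI (oddG_detP u w).

(** The triple [(f, p, u)] stands for [f + p + u] in
    [(F<t> (+) S_n' (x) F[tbar]) (+) F[tbar] (x) S_n V]. *)

Definition gam_car := (freeT * evI * oddG)%type.
HB.instance Definition _ := GRing.Lmodule.on gam_car.

Definition gam_mul (a b : gam_car) : gam_car :=
  let: (f, p, u) := a in
  let: (g, q, w) := b in
  (f * g,
   evI_act f q + evI_act g p + evI_mul p q + oddG_det u w,
   oddG_act f w + oddG_mul p w + oddG_act g u + oddG_mul q u).

Definition Gam : superalg F :=
  @Superalg F gam_car gam_mul (1, 0, 0)
    (fun a => a.2 == 0) (fun a => a.1 == 0).

Definition gam_t (i : 'I_m) : Gam := (<< fmu i >> : freeT, 0, 0).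

Fact gam_vP (j : 'I_n) :
  (((vv F j).1)%:MP, ((vv F j).2)%:MP) \in oddG_pred.
Proof.
apply/asboolP => k; rewrite !mcoeffC.
have [_|_] := eqVneq k 0%MM; rewrite ?mulr1 ?mulr0; last exact: lspan0.
exact: SnV_vv.
Qed.
Definition gam_v (j : 'I_n) : Gam := (0, 0, OddG (gam_vP j)).

End Tensor.

(* Main.v *)
Require Import Defs.
From HB Require Import structures.
From mathcomp Require Import all_boot all_order all_algebra.
From mathcomp Require Import boolp.
From mathcomp Require Import monalg mpoly.
From mathcomp Require Import zify ring.

Set Implicit Arguments.
Unset Strict Implicit.
Unset Printing Implicit Defensive.

Import Order.TTheory GRing.Theory.
Local Open Scope ring_scope.

(** In every Gamma-algebra the even part acts on the odd part, and on the
    products of two odd elements, through a commutative algebra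
    ([even_mulCA], [even_mulCA2]), and the cyclic identity gives the three-term
    Pluecker relation for the products [v_i v_j] ([plucker]). These are the
    relations that hold among the minors [alpha_ij] of a [2 x n] matrix and
    its columns, and they are enough for the classical straightening algorithm
    ([straighten]). Hence the subalgebra generated by even [t_i] and odd [v_j]
    is spanned by the values of normal words: arbitrary words in the [t_i], and
    sorted words in the [t_i] times a standard monomial in the [v_i v_j], with
    or without a last factor [v_j] ([span_word], [span_normal_mul]).

    In [Gam] the normal words take linearly independent values
    ([gvalue_free]): for the degree lexicographic order the leading monomial of
    [alpha_ij] is its diagonal term [x_i y_j] ([mlead_alpha]), and a standard
    monomial can be read off from its leading monomial ([lead_inj]). They also
    span [Gam] ([span_gam]), and [Gam] is a Gamma-algebra because it is a graded
    subalgebra of the product of the free associative algebra and of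
    [Gamma(A_n[tbar])] ([gam_gamma]).

    These facts give freeness without any computation of structure constants.
    Given images of the generators in a Gamma-algebra [H], the subalgebra of
    [Gam x H] generated by the pairs of corresponding generators is spanned by
    the pairs of values of normal words. Independence of the values in [Gam]
    makes it the graph of a function, spanning makes this function total, and a
    function whose graph is a graded subalgebra is a homomorphism
    ([gam_universal]). The same straightening and the same leading monomials,
    applied in [A_n^2], decompose [S_n V] into the [B_{n,j} V_j]
    ([SnV_direct_sum]). *)

(** * Spans, triangular families and graphs *)

Section LinearAlgebra.
Variable F : fieldType.

Definition image_on (V : lmodType F) (T : Type) (P : pred T) (e : T -> V) : V -> Prop :=
  fun x => exists2 i, P i & x = e i.

Lemma linear_fun0 (V W : lmodType F) (f : V -> W) : linear f -> f 0 = 0.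
Proof. by move=> /(_ (-1) 0 0); rewrite scaler0 addr0 scaleN1r addNr. Qed.

Lemma linear_funD (V W : lmodType F) (f : V -> W) : linear f -> {morph f : x y / x + y}.
Proof. by move=> fl x y; rewrite -[x]scale1r fl !scale1r. Qed.

Lemma linear_funN (V W : lmodType F) (f : V -> W) : linear f -> {morph f : x / - x}.
Proof.
by move=> fl x; rewrite -scaleN1r -[_ *: x]addr0 fl (linear_fun0 fl) addr0 scaleN1r.
Qed.

Lemma linear_funB (V W : lmodType F) (f : V -> W) : linear f -> {morph f : x y / x - y}.
Proof. by move=> fl x y; rewrite (linear_funD fl) (linear_funN fl). Qed.

Lemma linear_fun_sum (V W : lmodType F) (f : V -> W) (T : Type) (r : seq T)
    (g : T -> V) : linear f -> f (\sum_(i <- r) g i) = \sum_(i <- r) f (g i).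
Proof. by move=> fl; apply: big_morph; [apply: linear_funD | apply: linear_fun0]. Qed.

Lemma linear_funZ (V W : lmodType F) (f : V -> W) c :
  linear f -> {morph f : x / c *: x}.
Proof. by move=> fl x; rewrite -[_ *: x]addr0 fl (linear_fun0 fl) addr0. Qed.

Lemma lspanB (V : lmodType F) (X : V -> Prop) u w :
  lspan X u -> lspan X w -> lspan X (u - w).
Proof. by move=> Xu Xw; apply: lspanD => //; rewrite -scaleN1r; apply: lspanZ. Qed.

Lemma lspan_trans (V : lmodType F) (X Y : V -> Prop) u :
  (forall x, X x -> lspan Y x) -> lspan X u -> lspan Y u.
Proof. by move=> XY; apply: (lspan_map (f := id)). Qed.

Lemma lspan_combination (V : lmodType F) (T : eqType) (P : pred T) (e : T -> V) x :
  lspan (image_on P e) x ->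
  exists r (c : T -> F),
    [/\ uniq r, all P r & x = \sum_(i <- r) c i *: e i].
Proof.
elim=> [|a _ u [i Pi ->] _ [r [c [Ur Pr ->]]]].
  by exists [::], (fun=> 0); rewrite big_nil.
have [ir|ir] := boolP (i \in r).
  exists r, (fun j => if j == i then a + c i else c j); split=> //.
  rewrite (bigD1_seq i) //= [in RHS](bigD1_seq i) //= eqxx scalerDl -addrA.
  by congr (_ + (_ + _)); apply: eq_bigr => j /negPf->.
exists (i :: r), (fun j => if j == i then a else c j); split=> /=.
- by rewrite ir.
- by rewrite Pi.
rewrite big_cons eqxx; congr (_ + _); apply: eq_big_seq => j jr.
by case: eqP => // ji; rewrite -ji jr in ir.
Qed.

Lemma seq_argmax (T : eqType) d (O : orderType d) (rho : T -> O) (s : seq T) :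
  s != [::] -> exists2 i, i \in s & forall j, j \in s -> (rho j <= rho i)%O.
Proof.
elim: s => // i [|j s] IH _.
  by exists i; rewrite ?mem_head // => k; rewrite inE => /eqP->.
have [//|k ks kmax] := IH.
have [le_ki|lt_ik] := leP (rho k) (rho i).
  exists i; rewrite ?mem_head // => l; rewrite inE => /orP[/eqP->//|/kmax].
  by move/le_trans; apply.
exists k => [|l]; first by rewrite inE ks orbT.
by rewrite inE => /orP[/eqP->|/kmax//]; apply: ltW.
Qed.

(** A family is linearly independent as soon as it is triangular with respect
    to linear forms [lam] and a ranking [rho] of the indices: in a vanishing
    combination, the form attached to an index of maximal rank with a nonzero
    coefficient sees one term only. *)
Lemma triangular_free (V : lmodType F) (T : eqType) d (O : orderType d)
    (P : pred T) (e : T -> V) (lam : T -> V -> F^o) (rho : T -> O) :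
  (forall i, linear (lam i)) -> (forall i, P i -> lam i (e i) != 0) ->
  (forall i j, P i -> P j -> lam i (e j) != 0 -> i = j \/ (rho i < rho j)%O) ->
  forall r c, uniq r -> all P r -> \sum_(i <- r) c i *: e i = 0 ->
  forall i, i \in r -> c i = 0.
Proof.
move=> lamL lam_diag lam_tri r c Ur /allP Pr sum0 i ir.
apply/eqP/negPn/negP => ci0.
have [|k] := seq_argmax rho (s := [seq j <- r | c j != 0]).
  by rewrite -has_filter; apply/hasP; exists i.
rewrite mem_filter => /andP[ck0 kr] kmax.
have /eqP := congr1 (lam k) sum0.
rewrite (linear_fun0 (lamL k)) (linear_fun_sum _ _ (lamL k)).
rewrite (bigD1_seq k) //= big_seq_cond big1 ?addr0 => [|j /andP[jr jk]].
  rewrite (linear_funZ _ (lamL k)) [_ *: _]/(_ * _) mulf_eq0 (negPf ck0) /=.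
  by apply/negP/lam_diag/Pr.
rewrite (linear_funZ _ (lamL k)).
have [->|cj0] := eqVneq (c j) 0; first by rewrite scale0r.
have [->|lkj0] := eqVneq (lam k (e j)) 0; first by rewrite scaler0.
have [kj|] := lam_tri k j (Pr k kr) (Pr j jr) lkj0; first by rewrite kj eqxx in jk.
by rewrite ltNge kmax // mem_filter cj0.
Qed.

(** Prescribing the images of a linearly independent family defines a linear
    map on its span. The map is represented by its graph, so that it can be
    handled before it is known to be defined everywhere. *)
Lemma free_graph (V W : lmodType F) (T : eqType) (P : pred T)
    (e : T -> V) (e' : T -> W) :
  (forall r c, uniq r -> all P r -> \sum_(i <- r) c i *: e i = 0 ->
     forall i, i \in r -> c i = 0) ->
  forall z, lspan (image_on P (fun i => (e i, e' i))) z -> z.1 = 0 -> z.2 = 0.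
Proof.
move=> e_free _ /lspan_combination[r [c [Ur Pr ->]]].
rewrite (raddf_sum fst) (raddf_sum snd) => /(e_free _ _ Ur Pr) c0.
by rewrite big_seq big1 // => i /c0 ci0; rewrite ci0 scale0r.
Qed.

End LinearAlgebra.

(** * Straightening *)

(** Un-nesting two segments decreases the sum of their squared lengths: if [p],
    [q] and [r] are the successive gaps between the four points, the sum decreases
    by [2pr] in the first case and by more in the second one. *)
Lemma nested_sqr_lt (i k l j : nat) : (i < k)%N -> (k < l)%N -> (l < j)%N ->
  ((l - i) ^ 2 + (j - k) ^ 2 < (j - i) ^ 2 + (l - k) ^ 2)%N /\
  ((k - i) ^ 2 + (j - l) ^ 2 < (j - i) ^ 2 + (l - k) ^ 2)%N.
Proof.
move=> ik kl lj; pose p := (k - i)%N; pose q := (l - k)%N; pose r := (j - l)%N.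
have -> : (l - i = p + q)%N by rewrite /p /q; lia.
have -> : (j - k = q + r)%N by rewrite /q /r; lia.
have -> : (j - i = p + q + r)%N by rewrite /p /q /r; lia.
have p0 : (0 < p)%N by rewrite subn_gt0.
have r0 : (0 < r)%N by rewrite subn_gt0.
rewrite -/p -/q -/r; have := muln_gt0 p r; rewrite p0 r0 !sqrnD !mulnDl; nia.
Qed.

Section Straightening.
Variable n : nat.
Implicit Types (s t : seq ('I_n * 'I_n)) (o : option 'I_n) (i j k l : 'I_n).

Lemma ltpairs_cons p s : ltpairs (p :: s) = (p.1 < p.2)%N && ltpairs s.
Proof. by []. Qed.

(** If no pair of [s] is nested in another one, the lexicographic order on the
    pairs of [s] is the product order, so that sorting makes [s] standard. *)
Lemma nested_or_standard s : ltpairs s ->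
  (exists2 s', standard s' & perm_eq s s') \/
  (exists i k l j t, [/\ (i < k)%N, (k < l)%N, (l < j)%N
     & perm_eq s [:: (i, j), (k, l) & t]]).
Proof.
move=> lts.
have [/hasP[[i j] ps /hasP[[k l] qs /andP[/= ik lj]]]|not_nested] := boolP
  (has (fun p : 'I_n * 'I_n =>
     has (fun q : 'I_n * 'I_n => (p.1 < q.1) && (q.2 < p.2))%N s) s).
  right; exists i, k, l, j, (rem (k, l) (rem (i, j) s)); split=> //.
    exact: (allP lts _ qs).
  apply: (perm_trans (perm_to_rem ps)); rewrite perm_cons perm_to_rem //.
  rewrite rem_mem //; apply/eqP => -[ki _]; by rewrite ki ltnn in ik.
left; pose lex (p q : 'I_n * 'I_n) :=
  ((p.1 < q.1) || (p.1 == q.1 :> nat) && (p.2 <= q.2))%N.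
have lex_total : total lex by move=> [a b] [c d]; rewrite /lex /=; lia.
exists (sort lex s); last by rewrite perm_sym perm_sort.
rewrite /standard {1}/ltpairs all_sort -/(ltpairs s) lts /=.
have : all (mem s) (sort lex s) by apply/allP => p; rewrite mem_sort.
move/(sub_in_sorted (P := mem s) (e := lex)); apply; last exact: sort_sorted.
move=> p q ps qs; move/hasPn: not_nested => /(_ p ps) /hasPn/(_ q qs).
by rewrite /lex /=; lia.
Qed.

(** The monomials indexed by [s], followed by the odd letter [o] if there is one.
    An odd letter [j] behaves like a pair [(-1, j)] at the head of [s]: this
    turns the condition defining [B_{n,j}] into the condition that the longer
    list be standard, and accounts for the last term of [width]. *)
Definition standard_word s o : bool :=
  standard s && (if o is Some k then if s is p :: _ then (k <= p.2)%N else true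
                 else true).

Definition width s o : nat :=
  (\sum_(p <- s) (p.2 - p.1) ^ 2 + (if o is Some k then k.+1 ^ 2 else 0))%N.

(** Rewriting a nested pair by the Pluecker relation, or a head pair nested in
    the odd letter by the cyclic relation, decreases the sum of the squared
    lengths of the segments. The value [phi] of a word is kept abstract because
    the same algorithm is run in all Gamma-algebras and in [A_n^2]; the sizes are
    recorded because [normal] treats the words without odd letters apart. *)
Lemma straighten (F : fieldType) (W : lmodType F)
    (phi : seq ('I_n * 'I_n) -> option 'I_n -> W) :
  (forall s t o, perm_eq s t -> phi s o = phi t o) ->
  (forall i k l j t o, (i < k)%N -> (k < l)%N -> (l < j)%N ->
     phi [:: (i, j), (k, l) & t] o
     = phi [:: (i, l), (k, j) & t] o - phi [:: (i, k), (l, j) & t] o) ->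
  (forall i k j t, (i < k)%N -> (k < j)%N ->
     phi ((i, k) :: t) (Some j)
     = phi ((i, j) :: t) (Some k) - phi ((k, j) :: t) (Some i)) ->
  forall s o, ltpairs s ->
    lspan (fun x => exists s' o', [/\ standard_word s' o', size s' = size s,
                                     isSome o' = isSome o & x = phi s' o'])
      (phi s o).
Proof.
move=> phi_perm phi_plucker phi_cyc s o.
have [N] := ubnP (width s o); elim: N s o => // N IH s o /ltnSE sN lts.
have IH' s1 o1 : (width s1 o1 < width s o)%N -> ltpairs s1 -> size s1 = size s ->
    isSome o1 = isSome o ->
    lspan (fun x => exists s' o', [/\ standard_word s' o', size s' = size s,
                                     isSome o' = isSome o & x = phi s' o'])
      (phi s1 o1).
  by move=> /leq_trans/(_ sN) w1 lt1 <- <-; apply: IH.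
have [[s' std_s' ps']|[i [k [l [j [t [ik kl lj pst]]]]]]] := nested_or_standard lts.
  have ls' : ltpairs s' by case/andP: std_s'.
  have [hd|] := boolP (standard_word s' o).
    rewrite (phi_perm _ _ _ ps'); apply: lspan_mem; exists s', o.
    by rewrite (perm_size ps').
  rewrite /standard_word std_s' /=; case Do: o => [j|] //.
  case Ds': s' => [|[i k] t] //=; rewrite -ltnNge => kj; subst s' o.
  move: (ls'); rewrite ltpairs_cons => /andP[/= ik lt].
  have ws : width s (Some j) = width ((i, k) :: t) (Some j).
    by rewrite /width (perm_big _ ps').
  rewrite (phi_perm _ _ _ ps') phi_cyc //.
  (* The odd letter [j] as the segment from 0 to [j + 1], everything else being
     shifted by one. *)
  have := @nested_sqr_lt 0 i.+1 k.+1 j.+1 isT ik kj; rewrite !subSS !subn0 => -[w1 w2].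
  apply: lspanB; apply: IH';
    rewrite ?ws /width ?big_cons ?ltpairs_cons ?(perm_size ps') //= ?lt ?andbT;
    first [by clear -w1 w2; lia | by clear -ik kj; lia].
have ws : width s o = width [:: (i, j), (k, l) & t] o.
  by rewrite /width (perm_big _ pst).
have lt : ltpairs t.
  by move: lts; rewrite /ltpairs (perm_all _ pst) /= => /and3P[].
rewrite (phi_perm _ _ _ pst) phi_plucker //.
have [w1 w2] := nested_sqr_lt ik kl lj.
apply: lspanB; apply: IH';
  rewrite ?ws /width ?big_cons ?ltpairs_cons ?(perm_size pst) //= ?lt ?andbT;
    first [by rewrite !addnA !ltn_add2r | by clear -ik kl lj; lia].
Qed.

End Straightening.

(** * Identities of Gamma-algebras *)

(** Commutation is required on an invariant set [D] only: the even elements of a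
    Gamma-algebra need not commute, except in their action on some elements. *)
Lemma foldr_perm (T : Type) (I : eqType) (D : T -> Prop) (f : I -> T -> T) s s' h :
  (forall i x, D x -> D (f i x)) ->
  (forall i j x, D x -> f i (f j x) = f j (f i x)) ->
  D h -> perm_eq s s' -> foldr f h s = foldr f h s'.
Proof.
move=> Df fC Dh.
have Dfold r x : D x -> D (foldr f x r).
  by move=> Dx; elim: r => //= i r; apply: Df.
apply: (@catCA_perm_subst _ _ (foldr f h)) => s1 s2 s3.
rewrite !foldr_cat; have := Dfold s3 h Dh; move: (foldr f h s3) => x Dx.
elim: s1 => //= i s1 ->; elim: s2 => //= j s2 <-.
by rewrite fC //; do 2!apply: (Dfold).
Qed.

Section GammaAlgebra.
Variables (F : fieldType) (K : superalg F).
Hypothesis K_gamma : is_gamma_alg K.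

Local Notation "x ** y" := (@sa_mul F K x y) (at level 40, left associativity).
Local Notation K0 := (@sa_even F K).
Local Notation K1 := (@sa_odd F K).
Let K_super := ga_super K_gamma.

Lemma sa_mulDl x y z : (x + y) ** z = x ** z + y ** z.
Proof. exact: (linear_funD (sa_linl K_super z)). Qed.
Lemma sa_mulDr x y z : x ** (y + z) = x ** y + x ** z.
Proof. exact: (linear_funD (sa_linr K_super x)). Qed.
Lemma sa_mulNl x y : (- x) ** y = - (x ** y).
Proof. exact: (linear_funN (sa_linl K_super y)). Qed.
Lemma sa_mulNr x y : x ** (- y) = - (x ** y).
Proof. exact: (linear_funN (sa_linr K_super x)). Qed.
Lemma sa_0mul x : 0 ** x = 0.
Proof. exact: (linear_fun0 (sa_linl K_super x)). Qed.

Lemma even_mulA a x y : a \in K0 -> (a ** x) ** y = a ** (x ** y).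
Proof. by move=> a0; apply/subr0_eq/(ga_assoc K_gamma). Qed.

Lemma even_odd_comm a x : a \in K0 -> x \in K1 -> a ** x = x ** a.
Proof. by move=> a0 x1; apply/subr0_eq/(ga_comm01 K_gamma). Qed.

Lemma odd_mulC x y : x \in K1 -> y \in K1 -> x ** y = - (y ** x).
Proof. by move=> x1 y1; apply/eqP; rewrite -addr_eq0 (ga_skew K_gamma). Qed.

(** Skew-symmetry gives this outside characteristic 2 only, whence the separate
    hypothesis in characteristic 2. *)
Lemma odd_sqr x : x \in K1 -> x ** x = 0.
Proof.
move=> x1; have [F2|F2] := boolP (2%N \in [pchar F]).
  exact: (ga_alt K_gamma).
have /eqP := ga_skew K_gamma x1 x1; rewrite -mulr2n -scaler_nat scaler_eq0.
by case/orP => /eqP // two0; move: F2; rewrite inE /= two0 eqxx.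
Qed.

Lemma odd_mul_even x y : x \in K1 -> y \in K1 -> x ** y \in K0.
Proof. exact: (sa_11 K_super). Qed.

(** Although the even part need not be commutative, it acts on the odd part
    through a commutative algebra, because the action can be carried out from
    either side. *)
Lemma even_mulCA a b x : a \in K0 -> b \in K0 -> x \in K1 ->
  a ** (b ** x) = b ** (a ** x).
Proof.
move=> a0 b0 x1; have ax1 := sa_01 K_super a0 x1.
by rewrite (even_odd_comm b0 x1) -even_mulA // -even_odd_comm.
Qed.

Lemma even_mulCA2 a b x y : a \in K0 -> b \in K0 -> x \in K1 ->
  a ** (b ** (x ** y)) = b ** (a ** (x ** y)).
Proof.
move=> a0 b0 x1; rewrite -(even_mulA x y a0) -(even_mulA x y b0).
by rewrite -(even_mulA _ y a0) -(even_mulA _ y b0) even_mulCA.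
Qed.

Lemma odd_even_mulCA x a h : x \in K1 -> a \in K0 -> x ** (a ** h) = a ** (x ** h).
Proof.
move=> x1 a0; have [b [y [b0 y1 ->]]] := sa_decomp K_super h.
rewrite !sa_mulDr; congr (_ + _).
  rewrite -(even_odd_comm (sa_00 K_super a0 b0) x1) -(even_odd_comm b0 x1).
  exact: even_mulA.
have ay1 := sa_01 K_super a0 y1.
by rewrite (odd_mulC x1 ay1) (even_mulA _ _ a0) (odd_mulC x1 y1) sa_mulNr.
Qed.

Lemma pair_mulCA x y a h : x \in K1 -> y \in K1 -> a \in K0 ->
  (x ** y) ** (a ** h) = a ** ((x ** y) ** h).
Proof.
move=> x1 y1 a0; have xy0 := odd_mul_even x1 y1.
rewrite -(even_mulA a h xy0) -(even_mulA (x ** y) h a0); congr (_ ** _).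
exact/subr0_eq/(ec_comm (ga_center K_gamma x1 y1)).
Qed.

(** Multiplying the cyclic identity by a fourth odd element gives the Pluecker
    relation. *)
Lemma plucker x y z w : x \in K1 -> y \in K1 -> z \in K1 -> w \in K1 ->
  (x ** y) ** (z ** w) + (y ** z) ** (x ** w) + (z ** x) ** (y ** w) = 0.
Proof.
move=> x1 y1 z1 w1.
rewrite -(even_mulA z w (odd_mul_even x1 y1)) -(even_mulA x w (odd_mul_even y1 z1)).
by rewrite -(even_mulA y w (odd_mul_even z1 x1)) -!sa_mulDl (ga_cyc K_gamma) // sa_0mul.
Qed.

End GammaAlgebra.

(** * Normal words span a subalgebra *)

Section Words.
Variables (F : fieldType) (m n : nat).

(** The word [(w, s, o)] stands for the product of the [t_i] listed in [w], of
    the [v_i v_j] listed in [s], and of the odd letter [o]. *)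
Definition word := (seq 'I_m * seq ('I_n * 'I_n) * option 'I_n)%type.

(** The words without odd letters lie in the free associative algebra; in all
    other words the order of the [t_i] does not matter. *)
Definition normal (x : word) : bool :=
  let: (w, s, o) := x in
  standard_word s o &&
  ((s == [::]) && (o == None) || sorted (fun i j : 'I_m => (i <= j)%N) w).

Section Value.
Variables (K : superalg F) (t : 'I_m -> K) (v : 'I_n -> K).

Local Notation "x ** y" := (@sa_mul F K x y) (at level 40, left associativity).

Fixpoint act (w : seq 'I_m) (h : K) : K :=
  if w is i :: w' then t i ** act w' h else h.
Fixpoint pact (s : seq ('I_n * 'I_n)) (h : K) : K :=
  if s is p :: s' then (v p.1 ** v p.2) ** pact s' h else h.
Definition letter (o : option 'I_n) : K := if o is Some j then v j else sa_one K.
Definition value (x : word) : K := act x.1.1 (pact x.1.2 (letter x.2)).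

End Value.

Section Gamma.
Variables (K : superalg F) (t : 'I_m -> K) (v : 'I_n -> K).
Hypotheses (K_gamma : is_gamma_alg K).
Hypotheses (t_even : forall i, t i \in @sa_even F K).
Hypotheses (v_odd : forall j, v j \in @sa_odd F K).

Local Notation "x ** y" := (@sa_mul F K x y) (at level 40, left associativity).
Local Notation K0 := (@sa_even F K).
Local Notation K1 := (@sa_odd F K).
Local Notation act := (act t).
Local Notation pact := (pact v).
Local Notation letter := (letter v).
Local Notation value := (value t v).
Let K_super := ga_super K_gamma.

Let vv_even i j : v i ** v j \in K0.
Proof. exact: odd_mul_even. Qed.
Local Hint Resolve t_even v_odd vv_even : core.

Lemma act_foldr w h : act w h = foldr (fun i x => t i ** x) h w.
Proof. by elim: w => //= i w ->. Qed.

Lemma pact_foldr s h : pact s h = foldr (fun p x => (v p.1 ** v p.2) ** x) h s.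
Proof. by elim: s => //= p s ->. Qed.

Lemma act_cat w w' h : act (w ++ w') h = act w (act w' h).
Proof. by elim: w => //= i w ->. Qed.

Lemma pact_cat s s' h : pact (s ++ s') h = pact s (pact s' h).
Proof. by elim: s => //= p s ->. Qed.

Lemma act_linear w : linear (act w).
Proof. by elim: w => //= i w IH c x y; rewrite IH (sa_linr K_super). Qed.

Lemma pact_linear s : linear (pact s).
Proof. by elim: s => //= p s IH c x y; rewrite IH (sa_linr K_super). Qed.

Lemma act_mul w x y : act w x ** y = act w (x ** y).
Proof. by elim: w => //= i w <-; rewrite even_mulA. Qed.

Lemma pact_mul s x y : pact s x ** y = pact s (x ** y).
Proof. by elim: s => //= p s <-; rewrite even_mulA. Qed.

Lemma odd_actCA x w h : x \in K1 -> x ** act w h = act w (x ** h).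
Proof. by move=> x1; elim: w => //= i w <-; rewrite odd_even_mulCA. Qed.

Lemma odd_pactCA x s h : x \in K1 -> x ** pact s h = pact s (x ** h).
Proof. by move=> x1; elim: s => //= p s <-; rewrite odd_even_mulCA. Qed.

Lemma pact_actCA s w h : pact s (act w h) = act w (pact s h).
Proof.
elim: s => //= p s ->; elim: w => //= i w <-.
by rewrite pair_mulCA.
Qed.

Lemma pact_pairCA s x y h : x \in K1 -> y \in K1 ->
  pact s ((x ** y) ** h) = (x ** y) ** pact s h.
Proof. by move=> x1 y1; elim: s => //= p s ->; rewrite pair_mulCA ?odd_mul_even. Qed.

Lemma pact_perm s s' h : perm_eq s s' -> pact s h = pact s' h.
Proof.
rewrite !pact_foldr; apply: (@foldr_perm _ _ (fun=> True)) => // p q x _.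
by rewrite pair_mulCA.
Qed.

(** The elements on which the even part is known to act commutatively. *)
Definition absorbing (h : K) : Prop :=
  h \in K1 \/ exists x y, [/\ x \in K1, y \in K1 & h = x ** y].

Lemma absorbing_mul a h : a \in K0 -> absorbing h -> absorbing (a ** h).
Proof.
move=> a0 [h1|[x [y [x1 y1 ->]]]]; first by left; apply: sa_01.
by right; exists (a ** x), y; rewrite even_mulA ?(sa_01 K_super).
Qed.

Lemma act_perm w w' h : absorbing h -> perm_eq w w' -> act w h = act w' h.
Proof.
rewrite !act_foldr; apply: (@foldr_perm _ _ absorbing) => [i x|i j x].
  exact: absorbing_mul.
by case=> [x1|[y [z [y1 z1 ->]]]]; [apply: even_mulCA | apply: even_mulCA2].
Qed.

(** One odd letter or one pair [v_i v_j] is enough to make the order of the even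
    factors irrelevant. *)
Lemma pact_letter_absorbing s o : (s != [::]) || isSome o ->
  absorbing (pact s (letter o)).
Proof.
case: o => [j|] /=.
  by move=> _; left; elim: s => //= p s; apply: (sa_01 K_super).
rewrite orbF; case/lastP: s => // s p _.
rewrite -cats1 pact_cat /=.
elim: s => [|q s] /=; last exact: absorbing_mul.
by rewrite (ga_one K_gamma _).2; right; exists (v p.1), (v p.2).
Qed.

Definition span_normal : K -> Prop := lspan (image_on normal value).

Lemma span_word w s o : ltpairs s -> span_normal (value (w, s, o)).
Proof.
move=> lts; have [s0|s_odd] := boolP ((s == [::]) && (o == None)).
  apply: lspan_mem; exists (w, s, o) => //; rewrite /normal s0 andbT.
  by case/andP: s0 => /eqP-> /eqP->.
pose phi s o := value (w, s, o).
have phi_perm r r' q : perm_eq r r' -> phi r q = phi r' q.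
  by move=> rr'; rewrite /phi /value /= (pact_perm _ rr').
apply: lspan_trans (straighten phi_perm _ _ o lts) =>
  [_ [s' [o' [std_s' ss' oo' ->]]]|i k l j r q ik kl lj|i k j r ik kj].
- have w'w : perm_eq w (sort (fun i j : 'I_m => (i <= j)%N) w).
    by rewrite perm_sym perm_sort.
  apply: lspan_mem; exists (sort (fun i j : 'I_m => (i <= j)%N) w, s', o').
    rewrite /= std_s' sort_sorted ?orbT // => i j; exact: leq_total.
  rewrite /phi /value /= (act_perm _ w'w) //.
  apply: pact_letter_absorbing; rewrite oo' -size_eq0 ss' size_eq0.
  by case: (s == [::]) (o) s_odd => [] [].
- rewrite /phi /value /= -(linear_funB (act_linear w)); congr (act w _).
  rewrite -!(even_mulA K_gamma (v _ ** v _) _ (vv_even _ _)).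
  rewrite -(linear_funB (sa_linl K_super _)); congr (_ ** _).
  have /eqP := plucker K_gamma (v_odd i) (v_odd j) (v_odd k) (v_odd l).
  rewrite -addrA addr_eq0 => /eqP->.
  rewrite (odd_mulC K_gamma (v_odd j)) // (odd_mulC K_gamma (v_odd j) (v_odd l)) //.
  rewrite (odd_mulC K_gamma (v_odd k) (v_odd i)) // !sa_mulNl // sa_mulNr // opprK.
  rewrite opprD opprK; congr (_ - _); apply/subr0_eq.
  exact: ec_comm (ga_center K_gamma _ _) _ _.
rewrite /phi /value /= -(linear_funB (act_linear w)); congr (act w _).
rewrite -!pact_pairCA // -(linear_funB (pact_linear r)); congr (pact r _).
have /eqP := ga_cyc K_gamma (v_odd i) (v_odd k) (v_odd j).
rewrite -addrA addr_eq0 => /eqP->.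
by rewrite (odd_mulC K_gamma (v_odd j)) // sa_mulNl // opprD opprK addrC.
Qed.

(** All factors but the odd letters can be moved to the left, so that the product
    of two words is again a word, except that two odd letters merge into a pair
    that may have to be reoriented. *)
Lemma span_normal_mul x y :
  span_normal x -> span_normal y -> span_normal (x ** y).
Proof.
apply: (lspan_bil (sa_linl K_super) (sa_linr K_super)).
move=> x' y' [[[w s] o] /andP[/andP[/andP[ls _] _] _] ->].
case=> [[[w' s'] o'] /andP[/andP[/andP[ls' _] _] _] ->].
have -> : value (w, s, o) ** value (w', s', o')
    = act (w ++ w') (pact (s ++ s') (letter o ** letter o')).
  rewrite /value /= act_mul pact_mul act_cat pact_cat -(pact_actCA s w').
  congr (act w (pact s _)).
  case: o => [j|] /=; first by rewrite odd_actCA // odd_pactCA.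
  by rewrite !(ga_one K_gamma _).1.
have lss' : ltpairs (s ++ s') by rewrite /ltpairs all_cat; apply/andP.
case: o => [j|]; last by rewrite (ga_one K_gamma _).1; apply: span_word.
case: o' => [k|]; last first.
  by rewrite (ga_one K_gamma _).2; apply: (span_word _ (Some j)).
rewrite /= -[v j ** v k](ga_one K_gamma _).2 pact_pairCA //.
have [jk|kj|/val_inj->] := ltngtP j k.
- by apply: (@span_word _ ((j, k) :: s ++ s') None); rewrite ltpairs_cons /= jk.
- rewrite (odd_mulC K_gamma (v_odd j)) // sa_mulNl // (linear_funN (act_linear _)).
  rewrite -scaleN1r; apply: lspanZ.
  by apply: (@span_word _ ((k, j) :: s ++ s') None); rewrite ltpairs_cons /= kj.
- rewrite odd_sqr // sa_0mul // (linear_fun0 (act_linear _)).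
  exact: lspan0.
Qed.

Lemma span_one : span_normal (sa_one K).
Proof. exact: (@span_word [::] [::] None). Qed.

Lemma span_even i : span_normal (t i).
Proof. by rewrite -[t i](ga_one K_gamma _).2; apply: (@span_word [:: i] [::] None). Qed.

Lemma span_odd j : span_normal (v j).
Proof. exact: (@span_word [::] [::] (Some j)). Qed.

End Gamma.
End Words.

(** * Products and subalgebras of Gamma-algebras *)

Lemma hom_value (F : fieldType) (m n : nat) (G H : superalg F) (f : G -> H)
    (t : 'I_m -> G) (v : 'I_n -> G) (x : word m n) :
  is_superalg_hom f -> f (value t v x) = value (f \o t) (f \o v) x.
Proof.
move=> fh; case: x => [[w s] o]; rewrite /value /=.
elim: w => /= [|i w IH]; last by rewrite (sh_mul fh) IH.
elim: s => /= [|p s IH]; last by rewrite !(sh_mul fh) IH.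
by case: o => [//|] /=; apply: sh_one.
Qed.

Section Product.
Variables (F : fieldType) (G H : superalg F).

Definition prod_superalg : superalg F :=
  @Superalg F (G * H)%type
    (fun x y => (sa_mul x.1 y.1, sa_mul x.2 y.2)) (sa_one G, sa_one H)
    (fun x => (x.1 \in @sa_even F G) && (x.2 \in @sa_even F H))
    (fun x => (x.1 \in @sa_odd F G) && (x.2 \in @sa_odd F H)).

Lemma prod_evenE x : (x \in @sa_even F prod_superalg) =
  (x.1 \in @sa_even F G) && (x.2 \in @sa_even F H).
Proof. by []. Qed.

Lemma prod_oddE x : (x \in @sa_odd F prod_superalg) =
  (x.1 \in @sa_odd F G) && (x.2 \in @sa_odd F H).
Proof. by []. Qed.

Let prodE := (prod_evenE, prod_oddE).

Lemma prod_submod (P : {pred G}) (Q : {pred H}) : submod_closed P -> submod_closed Q ->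
  submod_closed (fun x : G * H => (x.1 \in P) && (x.2 \in Q)).
Proof.
move=> [P0 PL] [Q0 QL]; split=> [|c x y]; first by rewrite unfold_in /= P0.
rewrite !unfold_in => /andP[? ?] /andP[? ?].
by apply/andP; split; [apply: PL | apply: QL].
Qed.

Lemma prod_is_superalg : is_superalg G -> is_superalg H -> is_superalg prod_superalg.
Proof.
move=> SG SH; split.
- by move=> y c x z; congr pair; [apply: (sa_linl SG) | apply: (sa_linl SH)].
- by move=> y c x z; congr pair; [apply: (sa_linr SG) | apply: (sa_linr SH)].
- by apply: prod_submod; [apply: (sa_sub0 SG) | apply: (sa_sub0 SH)].
- by apply: prod_submod; [apply: (sa_sub1 SG) | apply: (sa_sub1 SH)].
- move=> [g h]; have [y [z [y0 z1 ->]]] := sa_decomp SG g.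
  have [y' [z' [y0' z1' ->]]] := sa_decomp SH h.
  by exists (y, y'), (z, z'); rewrite !prodE /= y0 y0' z1 z1'.
- move=> [g h]; rewrite !prodE => /andP[/= g0 h0] /andP[/= g1 h1].
  by rewrite (sa_disj SG g0 g1) (sa_disj SH h0 h1).
- move=> x y; rewrite !prodE /= => /andP[? ?] /andP[? ?].
  by rewrite (sa_00 SG) // (sa_00 SH).
- move=> x y; rewrite !prodE /= => /andP[? ?] /andP[? ?].
  by rewrite (sa_01 SG) // (sa_01 SH).
- move=> x y; rewrite !prodE /= => /andP[? ?] /andP[? ?].
  by rewrite (sa_10 SG) // (sa_10 SH).
- move=> x y; rewrite !prodE /= => /andP[? ?] /andP[? ?].
  by rewrite (sa_11 SG) // (sa_11 SH).
Qed.

Lemma prod_gamma : is_gamma_alg G -> is_gamma_alg H -> is_gamma_alg prod_superalg.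
Proof.
move=> GG GH; split.
- exact: prod_is_superalg (ga_super GG) (ga_super GH).
- by rewrite prodE !ga_one_even.
- move=> [x y]; have [x1 x2] := ga_one GG x; have [y1 y2] := ga_one GH y.
  by split; congr pair.
- move=> a b c; rewrite !prodE => /andP[? ?] /andP[? ?] /andP[? ?].
  by congr pair; [apply: (ga_assoc0 GG) | apply: (ga_assoc0 GH)].
- move=> a x; rewrite !prodE => /andP[? ?] /andP[? ?].
  by congr pair; [apply: (ga_comm01 GG) | apply: (ga_comm01 GH)].
- move=> a x y; rewrite !prodE => /andP[? ?].
  by congr pair; [apply: (ga_assoc GG) | apply: (ga_assoc GH)].
- move=> x y; rewrite !prodE => /andP[x1 x1'] /andP[y1 y1'].
  have [e1 c1 a1] := ga_center GG x1 y1; have [e2 c2 a2] := ga_center GH x1' y1'.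
  split; first by rewrite prodE /= e1.
    move=> a; rewrite prodE => /andP[? ?].
    by congr pair; [apply: c1 | apply: c2].
  move=> a b; rewrite !prodE => /andP[a0 a0'] /andP[b0 b0'].
  have [? ? ?] := a1 _ _ a0 b0; have [? ? ?] := a2 _ _ a0' b0'.
  by split; congr pair.
- move=> x y; rewrite !prodE => /andP[? ?] /andP[? ?].
  by congr pair; [apply: (ga_skew GG) | apply: (ga_skew GH)].
- move=> F2 x; rewrite !prodE => /andP[? ?].
  by congr pair; [apply: (ga_alt GG) | apply: (ga_alt GH)].
- move=> x y z; rewrite !prodE => /andP[? ?] /andP[? ?] /andP[? ?].
  by congr pair; [apply: (ga_cyc GG) | apply: (ga_cyc GH)].
Qed.

Lemma fst_hom : is_superalg_hom (fst : prod_superalg -> G).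
Proof. by split=> // x; rewrite prodE => /andP[]. Qed.

Lemma snd_hom : is_superalg_hom (snd : prod_superalg -> H).
Proof. by split=> // x; rewrite prodE => /andP[]. Qed.

End Product.

(** * [Gam] is a Gamma-algebra *)

(** [Gamma(A) = A (+) A^2]. *)
Section GammaOfRing.
Variables (F : fieldType) (A : comAlgType F).

Definition ring_gamma : superalg F :=
  @Superalg F (A * (A * A))%type
    (fun x y => (x.1 * y.1 + det2 x.2 y.2, scal2 x.1 y.2 + scal2 y.1 x.2))
    (1, 0) (fun x => x.2 == 0) (fun x => x.1 == 0).

Lemma ring_gamma_evenP (x : ring_gamma) : x \in @sa_even F ring_gamma ->
  exists a, x = (a, (0, 0)).
Proof. by case: x => a u /eqP /= ->; exists a. Qed.

Lemma ring_gamma_oddP (x : ring_gamma) : x \in @sa_odd F ring_gamma ->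
  exists u, x = (0, u).
Proof. by case: x => a u /eqP /= ->; exists u. Qed.

Lemma ring_gamma_mul00 (a b : A) :
  @sa_mul F ring_gamma (a, (0, 0)) (b, (0, 0)) = (a * b, (0, 0)).
Proof. by congr (_, (_, _)); rewrite /det2 /= /det2 /=; ring. Qed.

Lemma ring_gamma_mulE (a b : A) (u w : A * A) :
  @sa_mul F ring_gamma (a, u) (b, w)
  = (a * b + (u.1 * w.2 - u.2 * w.1), (a * w.1 + b * u.1, a * w.2 + b * u.2)).
Proof. by []. Qed.

Lemma ring_gamma_subE (a b a1 b1 a2 b2 : A) :
  a = b -> a1 = b1 -> a2 = b2 -> (a, (a1, a2)) - (b, (b1, b2)) = 0 :> ring_gamma.
Proof. by move=> -> -> ->; rewrite subrr. Qed.

Lemma ring_gamma_superalg : is_superalg ring_gamma.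
Proof.
split.
- move=> [b [w1 w2]] c [a [u1 u2]] [a' [u1' u2']].
  have [k kE] : exists k : A, forall x : A, c *: x = k * x.
    by exists c%:A => x; rewrite mulr_algl.
  by congr (_, (_, _)); rewrite /det2 /= !kE /det2 /=; ring.
- move=> [b [w1 w2]] c [a [u1 u2]] [a' [u1' u2']].
  have [k kE] : exists k : A, forall x : A, c *: x = k * x.
    by exists c%:A => x; rewrite mulr_algl.
  by congr (_, (_, _)); rewrite /det2 /= !kE /det2 /=; ring.
- split=> [|c x y]; first exact: eqxx.
  rewrite ![_ \in (fun _ => _)]unfold_in => /eqP x0 /eqP y0.
  by rewrite /= x0 y0 scaler0 addr0.
- split=> [|c x y]; first exact: eqxx.
  rewrite ![_ \in (fun _ => _)]unfold_in => /eqP x0 /eqP y0.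
  by rewrite /= x0 y0 scaler0 addr0.
- move=> [a u]; exists (a, 0), (0, u); rewrite !unfold_in /= !eqxx; split=> //.
  by congr pair; rewrite ?addr0 ?add0r.
- by move=> x /ring_gamma_evenP[a ->] /ring_gamma_oddP[u [-> _]].
- move=> _ _ /ring_gamma_evenP[a ->] /ring_gamma_evenP[b ->].
  by rewrite ring_gamma_mul00 unfold_in /= eqxx.
- move=> _ _ /ring_gamma_evenP[a ->] /ring_gamma_oddP[[w1 w2] ->].
  by rewrite ring_gamma_mulE unfold_in /= !(mulr0, mul0r) subr0 addr0.
- move=> _ _ /ring_gamma_oddP[[u1 u2] ->] /ring_gamma_evenP[b ->].
  by rewrite ring_gamma_mulE unfold_in /= !(mulr0, mul0r) subr0 addr0.
move=> _ _ /ring_gamma_oddP[[u1 u2] ->] /ring_gamma_oddP[[w1 w2] ->].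
by rewrite ring_gamma_mulE unfold_in /= !mul0r addr0.
Qed.

Lemma ring_gamma_gamma : is_gamma_alg ring_gamma.
Proof.
split; first exact: ring_gamma_superalg.
- by rewrite unfold_in /= eqxx.
- by move=> [a [u1 u2]]; split; congr (_, (_, _)); rewrite /det2 /=; ring.
- move=> _ _ _ /ring_gamma_evenP[a ->] /ring_gamma_evenP[b ->] /ring_gamma_evenP[c ->].
  by rewrite /sa_assoc !ring_gamma_mul00 mulrA subrr.
- move=> _ _ /ring_gamma_evenP[a ->] /ring_gamma_oddP[[w1 w2] ->].
  by rewrite /sa_comm !ring_gamma_mulE; apply: ring_gamma_subE; rewrite /det2 /=; ring.
- move=> _ [b [u1 u2]] [c [w1 w2]] /ring_gamma_evenP[a ->].
  by rewrite /sa_assoc !ring_gamma_mulE; apply: ring_gamma_subE; rewrite /det2 /=; ring.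
- move=> _ _ /ring_gamma_oddP[[u1 u2] ->] /ring_gamma_oddP[[w1 w2] ->].
  have -> : @sa_mul F ring_gamma (0, (u1, u2)) (0, (w1, w2))
      = (u1 * w2 - u2 * w1, (0, 0)).
    by congr (_, (_, _)); rewrite /det2 /= /det2 /=; ring.
  split=> [|_ /ring_gamma_evenP[a ->]|
    _ _ /ring_gamma_evenP[a ->] /ring_gamma_evenP[b ->]].
  + by rewrite unfold_in /= eqxx.
  + by rewrite /sa_comm !ring_gamma_mul00 mulrC subrr.
  + by rewrite /sa_assoc !ring_gamma_mul00 !mulrA !subrr.
- move=> _ _ /ring_gamma_oddP[[u1 u2] ->] /ring_gamma_oddP[[w1 w2] ->].
  by congr (_, (_, _)); rewrite /det2 /= /det2 /=; ring.
- move=> _ _ /ring_gamma_oddP[[u1 u2] ->].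
  by congr (_, (_, _)); rewrite /det2 /= /det2 /=; ring.
move=> _ _ _ /ring_gamma_oddP[[u1 u2] ->] /ring_gamma_oddP[[w1 w2] ->]
  /ring_gamma_oddP[[z1 z2] ->].
by congr (_, (_, _)); rewrite /det2 /= /det2 /=; ring.
Qed.

End GammaOfRing.

(** The free associative algebra, without odd part: the factor in which the
    order of the [t_i] is remembered. *)
Section EvenAlgebra.
Variables (F : fieldType) (m : nat).

Lemma malg_scalerAr c (f g : {malg F[{fmonom 'I_m}]}) : f * (c *: g) = c *: (f * g).
Proof.
pose k : {malg F[{fmonom 'I_m}]} := monalg.mkmalgU mone c.
have kE (h : {malg F[{fmonom 'I_m}]}) : c *: h = k * h by apply/esym/mul_malgC.
have cf : f * k = k * f.
  rewrite -kE malgM_def fgmulgU malgZ_def.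
  by apply: eq_bigr => l _; rewrite mulm1 mulrC.
rewrite (kE g).
rewrite (kE (f * g)).
apply: etrans (mulrA f k g) _.
rewrite cf.
exact: esym (mulrA k f g).
Qed.

Definition free_even : superalg F :=
  @Superalg F (freeT F m) *%R 1 predT (pred1 0).

Lemma free_even_gamma : is_gamma_alg free_even.
Proof.
have odd0 (x : freeT F m) : x \in @sa_odd F free_even -> x = 0 by move/eqP.
split.
- split=> //.
  + by move=> y c x z /=; rewrite mulrDl scalerAl.
  + by move=> y c x z /=; rewrite mulrDr (malg_scalerAr c y x).
  + split=> [|c x y]; first by rewrite unfold_in /=.
    by move=> /odd0-> /odd0->; rewrite scaler0 addr0 unfold_in /=.
  + by move=> x; exists x, 0; rewrite addr0; split=> //; rewrite unfold_in /=.
  + by move=> x _ /odd0.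
  + by move=> x y _ /odd0->; rewrite unfold_in /= mulr0.
  + by move=> x y /odd0-> _; rewrite unfold_in /= mul0r.
- by [].
- by move=> x; rewrite /= mul1r mulr1.
- by move=> a b c _ _ _; rewrite /sa_assoc /= mulrA subrr.
- by move=> a x _ /odd0->; rewrite /sa_comm /= mulr0 mul0r subrr.
- by move=> a b c _; rewrite /sa_assoc /= mulrA subrr.
- move=> x y /odd0-> _; rewrite /= mul0r; split=> //.
    by move=> a _; rewrite /sa_comm /= mulr0 mul0r subrr.
  by move=> a b _ _; rewrite /sa_assoc /= !(mulr0, mul0r) subrr.
- by move=> x y /odd0-> /odd0->; rewrite /= mulr0 addr0.
- by move=> _ x /odd0->; rewrite /= mulr0.
- by move=> x y z /odd0-> /odd0-> /odd0->; rewrite /= !mulr0 !addr0.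
Qed.

End EvenAlgebra.

(** The defining identities are inherited by graded subalgebras, here given by
    an injection; only the existence of homogeneous components is not. *)
Lemma subalgebra_gamma (F : fieldType) (G K : superalg F) (f : G -> K) :
  is_superalg_hom f -> injective f ->
  (forall x, (f x \in @sa_even F K) = (x \in @sa_even F G)) ->
  (forall x, (f x \in @sa_odd F K) = (x \in @sa_odd F G)) ->
  (forall x, exists y z, [/\ y \in @sa_even F G, z \in @sa_odd F G & x = y + z]) ->
  is_gamma_alg K -> is_gamma_alg G.
Proof.
move=> fh finj f0 f1 Gdec K_gamma; have KS := ga_super K_gamma.
have fl := sh_lin fh; have fM := sh_mul fh; have f1' := sh_one fh.
have fz : f 0 = 0 := linear_fun0 fl.
have fassoc x y z : f (sa_assoc x y z) = sa_assoc (f x) (f y) (f z).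
  by rewrite /sa_assoc (linear_funB fl) !fM.
have fcomm x y : f (sa_comm x y) = sa_comm (f x) (f y).
  by rewrite /sa_comm (linear_funB fl) !fM.
have inj0 x : f x = 0 -> x = 0 by rewrite -fz => /finj.
split.
- split.
  + by move=> y c x z; apply: finj; rewrite fM !fl !fM (sa_linl KS).
  + by move=> y c x z; apply: finj; rewrite fM !fl !fM (sa_linr KS).
  + have [K0 KL] := sa_sub0 KS.
    by split=> [|c x y]; rewrite -!f0 ?fz // fl; apply: KL.
  + have [K0 KL] := sa_sub1 KS.
    by split=> [|c x y]; rewrite -!f1 ?fz // fl; apply: KL.
  + exact: Gdec.
  + by move=> x; rewrite -f0 -f1 => x0 x1; apply/inj0/(sa_disj KS).
  + by move=> x y; rewrite -!f0 fM; apply: (sa_00 KS).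
  + by move=> x y; rewrite -f0 -!f1 fM; apply: (sa_01 KS).
  + by move=> x y; rewrite -f0 -!f1 fM; apply: (sa_10 KS).
  + by move=> x y; rewrite -f0 -!f1 fM; apply: (sa_11 KS).
- by rewrite -f0 f1'; apply: ga_one_even.
- by move=> x; have [? ?] := ga_one K_gamma (f x); split; apply: finj; rewrite fM f1'.
- move=> a b c; rewrite -!f0 => *; apply: inj0; rewrite fassoc.
  exact: (ga_assoc0 K_gamma).
- move=> a x; rewrite -f0 -f1 => *; apply: inj0; rewrite fcomm.
  exact: (ga_comm01 K_gamma).
- move=> a x y; rewrite -f0 => *; apply: inj0; rewrite fassoc.
  exact: (ga_assoc K_gamma).
- move=> x y; rewrite -!f1 => x1 y1; have [z0 zC zA] := ga_center K_gamma x1 y1.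
  split; first by rewrite -f0 fM.
    by move=> a; rewrite -f0 => a0; apply: inj0; rewrite fcomm fM; apply: zC.
  move=> a b; rewrite -!f0 => a0 b0; have [? ? ?] := zA _ _ a0 b0.
  by split; apply: inj0; rewrite fassoc fM.
- move=> x y; rewrite -!f1 => *; apply: inj0; rewrite (linear_funD fl) !fM.
  exact: (ga_skew K_gamma).
- move=> F2 x; rewrite -f1 => *; apply: inj0; rewrite fM.
  exact: (ga_alt K_gamma).
- move=> x y z; rewrite -!f1 => *; apply: inj0; rewrite !(linear_funD fl) !fM.
  exact: (ga_cyc K_gamma).
Qed.

Section GamGamma.
Variables (F : fieldType) (m n : nat).
Local Notation TA := (TA F m n).

Definition tbar (w : {fmonom 'I_m}) : TA := \prod_(i <- fmonom_val w) 'X_i.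

Fact tbar_mmorphism : mmorphism tbar.
Proof.
split; last by rewrite /tbar fm1 big_nil.
by move=> x y; rewrite /tbar fmM big_cat.
Qed.
HB.instance Definition _ :=
  monalg.isMultiplicative.Build {fmonom 'I_m} TA tbar tbar_mmorphism.

Lemma bar_linear : linear (@bar F m n).
Proof.
move=> c f g; rewrite [LHS](monalg.mmapD (h := tbar)).
rewrite [X in X + _](monalg.mmapZ (h := tbar)).
by rewrite /= mulr_algl.
Qed.

Lemma barM f g : bar n (f * g) = bar n f * bar n g :> TA.
Proof. exact: (monalg.mmap_is_multiplicative (h := tbar)).1. Qed.

Lemma bar1 : bar n 1 = 1 :> TA.
Proof. exact: (monalg.mmap_is_multiplicative (h := tbar)).2. Qed.

Lemma barU (w : {fmonom 'I_m}) : bar n << w >> = tbar w.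
Proof. by rewrite [LHS](monalg.mmapU (h := tbar)) /= scale1r mul1r. Qed.

Local Notation Gam := (Gam F m n).


Lemma evI_val_linear : linear (@evI_val F m n).
Proof. by move=> c p q; apply: (linearP (val : evI F m n -> TA)). Qed.

Lemma oddG_val_linear : linear (@oddG_val F m n).
Proof. by move=> c p q; apply: (linearP (val : oddG F m n -> (TA * TA)%type)). Qed.

(** The image of [f + p + u] in the even part of [Gamma(A_n[tbar])]. Its product
    rule is that of [Gamma(A_n[tbar])], without the cross terms that occur in
    [gam_mul]. *)
Definition even_bar (a : Gam) : TA := bar n a.1.1 + evI_val a.1.2.

(** The component [p] of [f + p + u] is the difference of [even_bar] and of
    [f(tbar)]; therefore this map is injective. *)
Definition gam_embed (a : Gam) : prod_superalg (free_even F m) (ring_gamma TA) :=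
  (a.1.1, (even_bar a, oddG_val a.2)).

Lemma gam_embed_inj : injective gam_embed.
Proof.
move=> [[f p] u] [[g q] w] e.
have fg : f = g := congr1 (fun x => x.1) e.
have pq : bar n f + evI_val p = bar n g + evI_val q := congr1 (fun x => x.2.1) e.
have uw : oddG_val u = oddG_val w := congr1 (fun x => x.2.2) e.
by rewrite fg in pq *; congr (_, _, _); apply: val_inj => //; apply: addrI pq.
Qed.

Lemma even_bar_linear : linear even_bar.
Proof.
move=> c a b; rewrite /even_bar [_.1.1]/(c *: a.1.1 + b.1.1) bar_linear.
by rewrite scalerDr addrACA.
Qed.

Lemma gam_embed_linear : linear gam_embed.
Proof. by move=> c a b; congr (_, (_, _)); apply: even_bar_linear. Qed.

Lemma even_bar_mul (a b : Gam) :
  even_bar (sa_mul a b) = even_bar a * even_bar b + det2 (oddG_val a.2) (oddG_val b.2).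
Proof.
move: a b => [[f p] u] [[g q] w].
have -> : even_bar (@sa_mul F Gam (f, p, u) (g, q, w)) =
    bar n (f * g) + (bar n f * evI_val q + bar n g * evI_val p
    + evI_val p * evI_val q + det2 (oddG_val u) (oddG_val w)) by [].
have -> : even_bar (f, p, u) = bar n f + evI_val p by [].
have -> : even_bar (g, q, w) = bar n g + evI_val q by [].
by rewrite barM mulrDl !mulrDr !addrA [evI_val p * bar n g]mulrC.
Qed.

Lemma scal2Dl (A : comNzRingType) (a b : A) u :
  scal2 (a + b) u = scal2 a u + scal2 b u.
Proof. by rewrite /scal2 !mulrDl. Qed.

Lemma odd_mul (a b : Gam) : oddG_val (sa_mul a b).2 =
  scal2 (even_bar a) (oddG_val b.2) + scal2 (even_bar b) (oddG_val a.2).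
Proof.
move: a b => [[f p] u] [[g q] w].
have -> : even_bar (f, p, u) = bar n f + evI_val p by [].
have -> : even_bar (g, q, w) = bar n g + evI_val q by [].
by rewrite !scal2Dl !addrA.
Qed.

Lemma gam_embed_mul (a b : Gam) :
  gam_embed (sa_mul a b) = sa_mul (gam_embed a) (gam_embed b).
Proof.
rewrite /gam_embed even_bar_mul odd_mul; congr (_, _).
by move: a b => [[f p] u] [[g q] w].
Qed.

Lemma gam_embed_even (a : Gam) :
  (gam_embed a \in @sa_even F _) = (a \in @sa_even F Gam).
Proof.
move: a => [[f p] u]; apply/andP/eqP => /= [[_ /eqP /= u0]|->].
  exact: val_inj.
by split=> //; apply/eqP.
Qed.

Lemma gam_embed_odd (a : Gam) :
  (gam_embed a \in @sa_odd F _) = (a \in @sa_odd F Gam).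
Proof.
move: a => [[f p] u]; apply/andP/eqP => /= [[/eqP /= f0 /eqP /= p0]|[-> ->]].
  rewrite /even_bar /= f0 (linear_fun0 bar_linear) add0r in p0.
  by congr (_, _) => //; apply: val_inj.
by rewrite !unfold_in /= /even_bar /= (linear_fun0 bar_linear) addr0.
Qed.

Lemma gam_embed_hom : is_superalg_hom gam_embed.
Proof.
split.
- exact: gam_embed_linear.
- by rewrite /gam_embed /even_bar bar1 addr0.
- exact: gam_embed_mul.
- by move=> a; rewrite gam_embed_even.
- by move=> a; rewrite gam_embed_odd.
Qed.

Lemma gam_gamma : is_gamma_alg Gam.
Proof.
apply: (subalgebra_gamma gam_embed_hom gam_embed_inj gam_embed_even gam_embed_odd).
  move=> [a u]; exists (a, 0), (0, u); rewrite !unfold_in /= !eqxx; split=> //.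
  by congr pair; rewrite ?addr0 ?add0r.
exact: prod_gamma (free_even_gamma F m) (ring_gamma_gamma TA).
Qed.

End GamGamma.

(** * Leading monomials of standard words *)

Section LeadingMonomials.
Variables (F : fieldType) (n : nat).
Implicit Types (s : seq ('I_n * 'I_n)) (o : option 'I_n).
Local Notation xvar i := (lshift n i).
Local Notation yvar j := (@rshift n n j).

Definition word_mnm k (w : seq 'I_k) : 'X_{1..k} := (\sum_(i <- w) U_(i))%MM.

Lemma word_mnmE k (w : seq 'I_k) i : word_mnm w i = count_mem i w.
Proof.
rewrite /word_mnm mnm_sumE -sum1_count [RHS]big_mkcond /=.
by apply: eq_bigr => j _; rewrite mnm1E; case: eqP.
Qed.

Lemma word_mnm_inj k (w w' : seq 'I_k) :
  sorted (fun i j : 'I_k => (i <= j)%N) w -> sorted (fun i j : 'I_k => (i <= j)%N) w' ->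
  word_mnm w = word_mnm w' -> w = w'.
Proof.
move=> sw sw' ww'; apply: sorted_eq sw sw' _.
- by move=> a b c; apply: leq_trans.
- by move=> a b /anti_leq/val_inj.
by apply/allP => i _ /=; rewrite -!word_mnmE ww'.
Qed.

Lemma word_mnm_surj k (e : 'X_{1..k}) : exists w, e = word_mnm w.
Proof.
rewrite [e]multinomUE_id; apply: (big_ind (fun d => exists w, d = word_mnm w)).
- by exists [::]; rewrite /word_mnm big_nil.
- by move=> _ _ [w ->] [w' ->]; exists (w ++ w'); rewrite /word_mnm big_cat.
move=> i _; elim: (e i) => [|d [w IH]].
  by exists [::]; rewrite /word_mnm big_nil mulm0n.
by exists (i :: w); rewrite mulmS IH /word_mnm big_cons.
Qed.

Definition yvars s o : seq 'I_n :=
  (if o is Some j then cons j else id) (unzip2 s).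

Definition lead s o : 'X_{1..n + n} :=
  (word_mnm (map (lshift n) (unzip1 s))
   + word_mnm (map (@rshift n n) (yvars s o)))%MM.

Lemma lead_x s o i : lead s o (xvar i) = count_mem i (unzip1 s).
Proof.
rewrite /lead mnmDE !word_mnmE !count_map.
rewrite [X in (_ + X)%N](@eq_count _ _ pred0) ?count_pred0 ?addn0.
  by apply: eq_count => j /=; rewrite eq_lshift.
by move=> j /=; rewrite eq_rlshift.
Qed.

Lemma lead_y s o i : lead s o (yvar i) = count_mem i (yvars s o).
Proof.
rewrite /lead mnmDE !word_mnmE !count_map.
rewrite [X in (X + _)%N](@eq_count _ _ pred0) ?count_pred0 ?add0n.
  by apply: eq_count => j /=; rewrite eq_rshift.
by move=> j /=; rewrite eq_lrshift.
Qed.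

Lemma standard_word_sorted s o : standard_word s o ->
  sorted (fun i j : 'I_n => (i <= j)%N) (unzip1 s) /\
  sorted (fun i j : 'I_n => (i <= j)%N) (yvars s o).
Proof.
case/andP=> /andP[_ ss] hd.
have s1 : sorted (fun i j : 'I_n => (i <= j)%N) (unzip1 s).
  by rewrite sorted_map; apply: sub_sorted ss => p q /andP[].
have s2 : sorted (fun i j : 'I_n => (i <= j)%N) (unzip2 s).
  by rewrite sorted_map; apply: sub_sorted ss => p q /andP[].
split=> //; rewrite /yvars; case: o hd => // j.
by case: s {ss s1} s2 => //= p s -> ->.
Qed.

(** A standard word is recovered from its leading monomial by sorting: the
    exponents of the [x_i] give the first indices, those of the [y_j] give the
    second indices, preceded by the index of the odd letter. *)
Lemma lead_inj s o s' o' : standard_word s o -> standard_word s' o' ->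
  isSome o = isSome o' -> lead s o = lead s' o' -> s = s' /\ o = o'.
Proof.
move=> /standard_word_sorted[s1 s2] /standard_word_sorted[s1' s2'] oo' lead_eq.
have eq_sorted (r r' : seq 'I_n) : sorted (fun i j : 'I_n => (i <= j)%N) r ->
    sorted (fun i j : 'I_n => (i <= j)%N) r' ->
    (forall i, count_mem i r = count_mem i r') -> r = r'.
  move=> sr sr' rr'; apply: word_mnm_inj => //.
  by apply/mnmP => i; rewrite !word_mnmE.
have e1 : unzip1 s = unzip1 s'.
  by apply: eq_sorted => // i; rewrite -(lead_x s o) lead_eq lead_x.
have e2 : yvars s o = yvars s' o'.
  by apply: eq_sorted => // i; rewrite -lead_y lead_eq lead_y.
have {}e2 : unzip2 s = unzip2 s' /\ o = o'.
  by case: o o' oo' e2 {s2 s2' lead_eq} => [j|] [j'|] //= _ [-> ->].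
case: e2 => e2 ->; split=> //.
by rewrite -[s]zip_unzip -[s']zip_unzip e1 e2.
Qed.

(** For an odd letter [j], the second coordinate of [amon s * v_j]. *)
Definition word_poly s o : An F n :=
  amon F s * (if o is Some j then 'X_(yvar j) else 1).

Lemma alphaE (i j : 'I_n) : alpha F i j =
  'X_[U_(xvar i) + U_(yvar j)] - 'X_[U_(yvar i) + U_(xvar j)].
Proof. by rewrite !mpolyXD. Qed.

(** In the degree lexicographic order with [x_1 > ... > x_n > y_1 > ... > y_n],
    the leading term of [alpha_ij] is its diagonal term [x_i y_j]. *)
Lemma mlead_alpha (i j : 'I_n) : (i < j)%N ->
  mlead (alpha F i j) = (U_(xvar i) + U_(yvar j))%MM /\
  (alpha F i j)@_(mlead (alpha F i j)) = 1.
Proof.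
move=> ij.
have lt_mnm : ((U_(yvar i) + U_(xvar j))%MM < (U_(xvar i) + U_(yvar j))%MM)%O.
  apply/ltmcP; first by rewrite !mdegD !mdeg1.
  exists (xvar i) => [k ki|]; rewrite !mnmDE !mnm1E.
    rewrite -!val_eqE /=; move: ki (ltn_ord i) => /=; lia.
  by rewrite eqxx eq_lshift eq_rlshift -val_eqE /= (gtn_eqF ij).
have ml : mlead (alpha F i j) = (U_(xvar i) + U_(yvar j))%MM.
  by rewrite alphaE mleadDl ?mleadN ?mleadXm.
split=> //; rewrite ml alphaE mcoeffB !mcoeffX eqxx.
by rewrite (lt_eqF lt_mnm) subr0.
Qed.

Lemma mlead_word_poly s o : ltpairs s ->
  mlead (word_poly s o) = lead s o /\ (word_poly s o)@_(lead s o) = 1.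
Proof.
move=> lts.
have c1 p : p \in s -> (alpha F p.1 p.2)@_(mlead (alpha F p.1 p.2)) = 1.
  by move=> /(allP lts) /mlead_alpha[].
have lreg p : p \in s -> true ->
    GRing.lreg (alpha F p.1 p.2)@_(mlead (alpha F p.1 p.2)).
  by move=> /c1-> _; apply: lreg1.
have lc : (amon F s)@_(mlead (amon F s)) = 1.
  by rewrite mleadc_prod_proper // big_seq big1.
pose q : An F n := if o is Some j then 'X_(yvar j) else 1.
have qc : q@_(mlead q) = 1.
  by rewrite /q; case: (o) => [j|]; rewrite ?mleadc1 ?mleadXm ?mcoeffX ?eqxx.
have ml : mlead (word_poly s o) = lead s o.
  rewrite /word_poly -/q mleadM_proper ?lc ?qc ?mul1r ?oner_neq0 //.
  rewrite mlead_prod_proper // [X in (X + _)%MM](_ : _ =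
    (word_mnm (map (lshift n) (unzip1 s))
     + word_mnm (map (@rshift n n) (unzip2 s)))%MM).
    rewrite /lead /yvars /q; case: (o) => [j|].
      rewrite mleadXm -addmA; congr (_ + _)%MM.
      by rewrite /word_mnm /= big_cons addmC.
    by rewrite mlead1 addm0.
  rewrite /word_mnm !big_map -big_split /=; apply: eq_big_seq => p ps.
  by have [] := mlead_alpha (allP lts p ps).
by split=> //; rewrite -ml mleadcM_proper ?lc ?qc ?mul1r ?oner_neq0.
Qed.

Lemma word_poly_triangular s o s' o' :
  standard_word s o -> standard_word s' o' -> isSome o = isSome o' ->
  (word_poly s' o')@_(lead s o) != 0 ->
  (s = s' /\ o = o') \/ (lead s o < lead s' o')%O.
Proof.
move=> std std' oo' nz.
have ls' : ltpairs s' by case/andP: std' => /andP[].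
have [ml _] := mlead_word_poly o' ls'.
have := msupp_le_mlead (p := word_poly s' o') (m := lead s o).
rewrite mcoeff_msupp nz ml => /(_ isT); rewrite le_eqVlt => /orP[/eqP eq_lead|].
  by left; apply: lead_inj.
by right.
Qed.

End LeadingMonomials.

(** * Values of words in [Gam] *)

Section GamBasis.
Variables (F : fieldType) (m n : nat).
Local Notation TA := (TA F m n).
Local Notation Gam := (Gam F m n).
Local Notation gact := (act (@gam_t F m n)).
Local Notation gpact := (pact (@gam_v F m n)).
Local Notation gvalue := (value (@gam_t F m n) (@gam_v F m n)).

Lemma free_mul (a b : Gam) : (sa_mul a b).1.1 = a.1.1 * b.1.1.
Proof. by move: a b => [[f p] u] [[g q] w]. Qed.

Lemma scal20 (A : comNzRingType) (a : A) : scal2 a 0 = 0.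
Proof. by rewrite /scal2 /= mulr0. Qed.

Lemma scal2_0 (A : comNzRingType) (u : A * A) : scal2 0 u = 0.
Proof. by rewrite /scal2 !mul0r. Qed.

Lemma scal2A (A : comNzRingType) (a b : A) u : scal2 a (scal2 b u) = scal2 (a * b) u.
Proof. by rewrite /scal2 /= !mulrA. Qed.

Lemma scal21 (A : comNzRingType) (u : A * A) : scal2 1 u = u.
Proof. by rewrite /scal2 !mul1r -surjective_pairing. Qed.

Lemma det20l (A : comNzRingType) (u : A * A) : det2 0 u = 0.
Proof. by rewrite /det2 /= !mul0r subr0. Qed.

Lemma even_bar_even_mul (a b : Gam) : oddG_val a.2 = 0 ->
  even_bar (sa_mul a b) = even_bar a * even_bar b.
Proof. by move=> a0; rewrite even_bar_mul a0 det20l addr0. Qed.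

Lemma odd_even_mul (a b : Gam) : oddG_val a.2 = 0 ->
  oddG_val (sa_mul a b).2 = scal2 (even_bar a) (oddG_val b.2).
Proof. by move=> a0; rewrite odd_mul a0 scal20 addr0. Qed.

Lemma even_bar_t i : even_bar (gam_t F n i : Gam) = 'X_i.
Proof.
rewrite /even_bar /= addr0 [LHS]barU /tbar fmU big_seq1 //.
Qed.

Lemma even_bar_v j : even_bar (gam_v F m j : Gam) = 0.
Proof. by rewrite /even_bar /= addr0 (linear_fun0 (@bar_linear F m n)). Qed.

Lemma pair_v i j : let p : Gam := sa_mul (gam_v F m i) (gam_v F m j) in
  [/\ p.1.1 = 0, even_bar p = (alpha F i j)%:MP & oddG_val p.2 = 0].
Proof.
split; first by rewrite free_mul mul0r.
  rewrite even_bar_mul even_bar_v mul0r add0r /alpha /det2 /=.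
  by rewrite mpolyCB !mpolyCM.
by rewrite odd_mul !even_bar_v !scal2_0 addr0.
Qed.

Lemma gact_cons i w h : gact (i :: w) h = @sa_mul F Gam (gam_t F n i) (gact w h).
Proof. by []. Qed.

Lemma gpact_cons p s h : gpact (p :: s) h =
  @sa_mul F Gam (sa_mul (gam_v F m p.1) (gam_v F m p.2)) (gpact s h).
Proof. by []. Qed.

Lemma free_act w h : (gact w h : Gam).1.1 = << FMonom w >> * h.1.1.
Proof.
elim: w => [|i w IH].
  by rewrite -[LHS]mul1r; congr (<< _ >> * _); rewrite -fmoneE.
rewrite gact_cons free_mul IH mulrA; congr (_ * _).
rewrite [LHS](fgmulUU 1 1) mulr1; congr << _ >>.
by rewrite [LHS]fmmulE fmU.
Qed.

Lemma even_bar_act w h : even_bar (gact w h : Gam) = 'X_[word_mnm w] * even_bar h.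
Proof.
elim: w => [|i w IH]; first by rewrite /word_mnm big_nil mpolyX0 mul1r.
rewrite gact_cons even_bar_even_mul // IH even_bar_t mulrA.
by rewrite /word_mnm big_cons mpolyXD.
Qed.

Lemma odd_act w h :
  oddG_val (gact w h : Gam).2 = scal2 'X_[word_mnm w] (oddG_val h.2).
Proof.
elim: w => [|i w IH]; first by rewrite /word_mnm big_nil mpolyX0 scal21.
rewrite gact_cons odd_even_mul; last by [].
rewrite IH even_bar_t scal2A; congr (scal2 _ _).
by rewrite /word_mnm big_cons; apply/esym/mpolyXD.
Qed.

Lemma free_pact s h : (gpact s h : Gam).1.1 = if s is [::] then h.1.1 else 0.
Proof.
case: s => // p s; rewrite gpact_cons free_mul.
by have [-> _ _] := pair_v p.1 p.2; rewrite mul0r.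
Qed.

Lemma even_bar_pact s h : even_bar (gpact s h : Gam) = (amon F s)%:MP * even_bar h.
Proof.
elim: s => [|p s IH]; first by rewrite /amon big_nil mpolyC1 mul1r.
have [_ tp op] := pair_v p.1 p.2.
by rewrite gpact_cons even_bar_even_mul // IH tp mulrA /amon big_cons mpolyCM.
Qed.

Lemma odd_pact s h :
  oddG_val (gpact s h : Gam).2 = scal2 (amon F s)%:MP (oddG_val h.2).
Proof.
elim: s => [|p s IH]; first by rewrite /amon big_nil mpolyC1 scal21.
have [_ tp op] := pair_v p.1 p.2.
rewrite gpact_cons odd_even_mul; last by [].
rewrite IH tp scal2A; congr (scal2 _ _).
by rewrite /amon big_cons; apply/esym/mpolyCM.
Qed.

Definition is_free_word (x : word m n) : bool := (x.1.2 == [::]) && (x.2 == None).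

Lemma free_gvalue (x : word m n) :
  (gvalue x).1.1 = if is_free_word x then << FMonom x.1.1 >> else 0.
Proof.
case: x => [[w s] o]; rewrite /value /is_free_word /= free_act free_pact.
case: s => [|p s]; last by rewrite mulr0.
by case: o => [j|] /=; rewrite ?mulr0 ?mulr1.
Qed.

Lemma evI_gvalue (w : seq 'I_m) s : evI_val (gvalue (w, s, None)).1.2 =
  if s is [::] then 0 else 'X_[word_mnm w] * (amon F s)%:MP.
Proof.
have : even_bar (gvalue (w, s, None)) = 'X_[word_mnm w] * (amon F s)%:MP.
  rewrite /value /= even_bar_act even_bar_pact; congr (_ * _).
  by rewrite /even_bar /= bar1 addr0 mulr1.
rewrite /even_bar free_gvalue /is_free_word /=.
case: s => [|p s] /=; last by rewrite (linear_fun0 (@bar_linear F m n)) add0r.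
rewrite /amon big_nil mpolyC1 mulr1 barU /tbar.
have -> : \prod_(i <- FMonom w) ('X_i : TA) = 'X_[word_mnm w].
  rewrite /word_mnm; elim: (w) => [|i w' IH]; first by rewrite !big_nil mpolyX0.
  by rewrite !big_cons IH mpolyXD.
by move=> /eqP; rewrite -subr_eq0 addrAC subrr add0r => /eqP.
Qed.

Lemma odd_gvalue (w : seq 'I_m) s j : oddG_val (gvalue (w, s, Some j)).2 =
  scal2 ('X_[word_mnm w] * (amon F s)%:MP) (((vv F j).1)%:MP, ((vv F j).2)%:MP).
Proof. by rewrite /value /= odd_act odd_pact scal2A. Qed.

Lemma even_gvalue_odd (w : seq 'I_m) s : oddG_val (gvalue (w, s, None)).2 = 0.
Proof. by rewrite /value /= odd_act odd_pact /= !scal20. Qed.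

Lemma odd_gvalue_even (w : seq 'I_m) s j : (gvalue (w, s, Some j)).1 = 0.
Proof.
suff : evI_val (gvalue (w, s, Some j)).1.2 = 0.
  move=> e0; rewrite [LHS]surjective_pairing free_gvalue /is_free_word andbF.
  by congr (_, _); apply: val_inj.
have := even_bar_act w (gpact s (gam_v F m j)).
rewrite even_bar_pact even_bar_v !mulr0 /even_bar.
rewrite [X in bar n X](free_gvalue (w, s, Some j)) /is_free_word andbF.
by rewrite (linear_fun0 (@bar_linear F m n)) add0r.
Qed.

End GamBasis.

(** * Independence of the normal words in [Gam] *)

Section Independence.
Variables (F : fieldType) (m n : nat).
Local Notation TA := (TA F m n).
Local Notation Gam := (Gam F m n).
Local Notation gvalue := (value (@gam_t F m n) (@gam_v F m n)).

(** The coefficient, in the component of the word [x], of the monomial that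
    leads the value of [x]. In the odd component the second coordinate is enough,
    because the second coordinate [b * y_j] of [b * v_j] determines [b] and [j]
    among the words considered. *)
Definition gam_coef (x : word m n) (a : Gam) : F^o :=
  if is_free_word x then monalg.mcoeff (FMonom x.1.1) a.1.1
  else ((if x.2 is Some _ then (oddG_val a.2).2 else evI_val a.1.2)
         @_(word_mnm x.1.1))@_(lead x.1.2 x.2).

Lemma TAcoeff_linear k l : linear (fun p : TA => p@_k@_l : F^o).
Proof. by move=> c p q; rewrite mcoeffD mcoeffTAZ mcoeffD mcoeffZ. Qed.

Lemma gam_coef_linear x : linear (gam_coef x).
Proof.
move=> c a b; rewrite /gam_coef; case: ifP => _.
  by rewrite [LHS]monalg.mcoeffD monalg.mcoeffZ.
case: x.2 => [j|].
  rewrite -[(c *: a + b).2]/(c *: a.2 + b.2) oddG_val_linear.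
  exact: TAcoeff_linear.
rewrite -[(c *: a + b).1.2]/(c *: a.1.2 + b.1.2) evI_val_linear.
exact: TAcoeff_linear.
Qed.

Lemma TAcoeffXC k (a : An F n) k' :
  ('X_[k] * a%:MP : TA)@_k' = if k == k' then a else 0.
Proof. by rewrite mulrC mcoeffCM mcoeffX; case: eqP; rewrite ?mulr1 ?mulr0. Qed.

Lemma gam_coef_value x y : gam_coef x (gvalue y) =
  if is_free_word x then (is_free_word y && (x.1.1 == y.1.1))%:R
  else if is_free_word y || (isSome x.2 != isSome y.2) then 0
  else if word_mnm x.1.1 == word_mnm y.1.1
       then (word_poly F y.1.2 y.2)@_(lead x.1.2 x.2) else 0.
Proof.
rewrite /gam_coef; case: ifP => [_|fx].
  rewrite free_gvalue; case: (is_free_word y); last exact: monalg.mcoeff0.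
  by rewrite [LHS]mcoeffU1 -val_eqE eq_sym.
case: x y fx => [[w s] o] [[w' s'] o'] /= _.
case: o => [j|]; case: o' => [j'|] /=.
- rewrite odd_gvalue /is_free_word andbF /= -mulrA -mpolyCM TAcoeffXC eq_sym.
  by case: eqP => // _; rewrite mcoeff0.
- by rewrite even_gvalue_odd /is_free_word /= orbT !mcoeff0.
- by rewrite odd_gvalue_even /is_free_word orbT !mcoeff0.
rewrite evI_gvalue /is_free_word /= orbF andbT.
case: s' => [|p s']; first by rewrite !mcoeff0.
rewrite TAcoeffXC eq_sym /word_poly mulr1.
by case: eqP => // _; rewrite mcoeff0.
Qed.

Lemma gam_coef_diag x : normal x -> gam_coef x (gvalue x) != 0.
Proof.
case: x => [[w s] o] /andP[/andP[/andP[ls _] _] _].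
rewrite gam_coef_value /=; case: ifP => [->|->]; first by rewrite eqxx oner_neq0.
rewrite !eqxx /=.
by have [_ ->] := mlead_word_poly F o ls; rewrite oner_neq0.
Qed.

Lemma gam_coef_triangular x y : normal x -> normal y ->
  gam_coef x (gvalue y) != 0 ->
  x = y \/ (lead x.1.2 x.2 < lead y.1.2 y.2)%O.
Proof.
case: x y => [[w s] o] [[w' s'] o'] /andP[std nx] /andP[std' ny].
rewrite gam_coef_value /=; case: ifP => [fx|fx].
  have [/= /andP[fy /eqP ww'] _|] := boolP (_ && _); last by rewrite eqxx.
  left; case/andP: fx => /= /eqP-> /eqP->; case/andP: fy => /= /eqP-> /eqP->.
  by rewrite ww'.
case: ifP; first by rewrite eqxx.
move=> /negbT; rewrite negb_or negbK => /andP[fy /eqP oo'].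
case: (word_mnm w =P word_mnm w') => [ww'|_]; last by rewrite eqxx.
have {}ww' : w = w'.
  rewrite /is_free_word /= in fx fy; rewrite fx /= in nx; rewrite (negPf fy) /= in ny.
  exact: word_mnm_inj.
move=> /(word_poly_triangular std std' oo') [[-> ->]|]; last by right.
by left; rewrite ww'.
Qed.

Lemma gvalue_free r (c : word m n -> F) : uniq r -> all (@normal m n) r ->
  \sum_(x <- r) c x *: gvalue x = 0 -> forall x, x \in r -> c x = 0.
Proof.
exact: (triangular_free (rho := fun x => lead x.1.2 x.2)
  gam_coef_linear gam_coef_diag gam_coef_triangular).
Qed.

End Independence.

(** * The normal words span [Gam] *)

Section Spanning.
Variables (F : fieldType) (m n : nat).
Local Notation TA := (TA F m n).
Local Notation Gam := (Gam F m n).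
Local Notation gvalue := (value (@gam_t F m n) (@gam_v F m n)).
Local Notation span := (span_normal (@gam_t F m n) (@gam_v F m n)).

(** Spans in a subspace such as [evI] can be computed in the ambient space, as
    soon as the generators lie in the subspace. *)
Lemma lspan_inj_lift (V W : lmodType F) (f : V -> W) (X : W -> Prop)
    (Y : V -> Prop) u :
  linear f -> injective f -> (forall x, X x -> exists2 y, Y y & f y = x) ->
  lspan X (f u) -> lspan Y u.
Proof.
move=> fl finj XY Xfu.
suff [v Yv /finj <-//] : exists2 v, lspan Y v & f v = f u by [].
elim: Xfu => [|c x w Xx _ [v Yv <-]].
  by exists 0; [apply: lspan0 | apply: linear_fun0].
by have [y Yy <-] := XY x Xx; exists (c *: y + v); rewrite ?fl //; apply: lspanS.
Qed.

Lemma gam_triple (a : Gam) f p u :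
  a.1.1 = f -> evI_val a.1.2 = evI_val p -> oddG_val a.2 = oddG_val u -> a = (f, p, u).
Proof. by case: a => [[g q] w] /= -> /val_inj-> /val_inj->. Qed.

Lemma gam_t_even i : gam_t F n i \in @sa_even F Gam.
Proof. exact: eqxx. Qed.

Lemma gam_v_odd j : gam_v F m j \in @sa_odd F Gam.
Proof. exact: eqxx. Qed.

Lemma span_gvalue w s o : ltpairs s -> span (gvalue (w, s, o)).
Proof.
by move=> ls; apply: (span_word (gam_gamma F m n) gam_t_even gam_v_odd).
Qed.

Lemma span_free (f : freeT F m) : span (f, 0, 0).
Proof.
have fl : linear (fun f : freeT F m => (f, 0, 0) : Gam).
  by move=> c g h; congr (_, _, _); rewrite /= scaler0 addr0.
apply: (lspan_map (X := fun g => exists w, g = << FMonom w >>) fl) => [_ [w ->]|].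
  have -> : (<< FMonom w >>, 0, 0) = gvalue (w, [::], None).
    apply/esym/gam_triple; first by rewrite free_gvalue.
      by rewrite evI_gvalue.
    by rewrite even_gvalue_odd.
  exact: span_gvalue.
rewrite [f]monalgE; apply: lspan_sum => w.
have -> : monalg.mkmalgU w (monalg.mcoeff w f) = monalg.mcoeff w f *: << w >>.
  by apply/malgP => k; rewrite monalg.mcoeffZ !mcoeffU; apply/esym/mulr_natr.
by apply: lspanZ; apply: lspan_mem; exists w; rewrite fmK.
Qed.

Lemma tbar_linear (w : seq 'I_m) :
  linear (fun a : An F n => 'X_[word_mnm w] * a%:MP : TA).
Proof.
move=> c a b; rewrite mpolyCD mulrDr; congr (_ + _).
by rewrite -mul_mpolyC mpolyCM mulrCA.
Qed.

Lemma span_evI (p : evI F m n) : span (0, p, 0).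
Proof.
have fl : linear (fun p : evI F m n => (0, p, 0) : Gam).
  by move=> c g h; congr (_, _, _); rewrite /= scaler0 addr0.
apply: (lspan_map (X := fun q => span (0, q, 0)) fl) => //.
pose X (q : TA) := exists w s, [/\ ltpairs s, s != [::] &
  q = 'X_[word_mnm w] * (amon F s)%:MP].
apply: (lspan_inj_lift (X := X) (@evI_val_linear F m n) val_inj) =>
  [_ [w [s [ls s0 ->]]]|].
  have <- : evI_val (gvalue (w, s, None)).1.2 = 'X_[word_mnm w] * (amon F s)%:MP.
    by rewrite evI_gvalue; case: s s0 {ls}.
  eexists; last by [].
  have := span_gvalue w None ls; congr (span _); apply: gam_triple => //.
    by rewrite free_gvalue /is_free_word /= (negPf s0).
  by rewrite even_gvalue_odd.
have /asboolP Sp : evI_val p \in @evI_pred F m n := valP p.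
have -> : evI_val p = \sum_(k <- msupp (evI_val p)) 'X_[k] * ((evI_val p)@_k)%:MP.
  rewrite [LHS]mpolyE; apply: eq_bigr => k _.
  by rewrite -mul_mpolyC mulrC.
apply: lspan_sum => k; have [w ->] := word_mnm_surj k.
apply: (lspan_map (tbar_linear w)) (Sp _) => _ [s /andP[ls s0] ->].
by apply: lspan_mem; exists w, s.
Qed.

Lemma span_oddG (u : oddG F m n) : span (0, 0, u).
Proof.
have fl : linear (fun u : oddG F m n => (0, 0, u) : Gam).
  by move=> c g h; congr (_, _, _); rewrite /= scaler0 addr0.
apply: (lspan_map (X := fun q => span (0, 0, q)) fl) => //.
pose X (q : TA * TA) := exists w s j, ltpairs s /\
  q = scal2 ('X_[word_mnm w] * (amon F s)%:MP) (((vv F j).1)%:MP, ((vv F j).2)%:MP).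
apply: (lspan_inj_lift (X := X) (@oddG_val_linear F m n) val_inj) =>
  [_ [w [s [j [ls ->]]]]|].
  rewrite -odd_gvalue; eexists; last by [].
  have := span_gvalue w (Some j) ls.
  by congr (span _); apply: gam_triple; rewrite ?odd_gvalue_even.
have /asboolP Su : oddG_val u \in @oddG_pred F m n := valP u.
(* A common bound on the degrees, to expand both coordinates over the same
   monomials. *)
pose N := maxn (msize (oddG_val u).1) (msize (oddG_val u).2).
have -> : oddG_val u = \sum_(k : 'X_{1..m < N})
    (('X_[k] : TA) * ((oddG_val u).1@_k)%:MP, ('X_[k] : TA) * ((oddG_val u).2@_k)%:MP).
  rewrite [LHS]surjective_pairing [RHS]surjective_pairing.
  rewrite (raddf_sum fst) (raddf_sum snd) /=.
  congr (_, _).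
    rewrite [LHS](mpolywE (k := N)) ?leq_maxl //; apply: eq_bigr => k _.
    by rewrite -mul_mpolyC mulrC.
  rewrite [LHS](mpolywE (k := N)) ?leq_maxr //; apply: eq_bigr => k _.
  by rewrite -mul_mpolyC mulrC.
apply: lspan_sum => k; have [w ->] := word_mnm_surj k.
have gl : linear (fun a : An F n * An F n =>
    (('X_[word_mnm w] : TA) * a.1%:MP, ('X_[word_mnm w] : TA) * a.2%:MP)).
  by move=> c a b; congr (_, _); apply: tbar_linear.
apply: (lspan_map gl) (Su _) => _ [a Sa [j ->]].
have hl : linear (fun a : An F n => scal2 ('X_[word_mnm w] * a%:MP : TA)
   (((vv F j).1)%:MP, ((vv F j).2)%:MP)).
  move=> c b d; rewrite mpolyCD mulrDr scal2Dl; congr (_ + _).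
  rewrite -mul_mpolyC mpolyCM mulrCA.
  by congr (_, _); rewrite /= -mulrA.
have -> : ('X_[word_mnm w] * (scal2 a (vv F j)).1%:MP : TA,
    'X_[word_mnm w] * (scal2 a (vv F j)).2%:MP : TA) =
  scal2 ('X_[word_mnm w] * a%:MP : TA) (((vv F j).1)%:MP, ((vv F j).2)%:MP).
  by rewrite /scal2 /= !mpolyCM !mulrA.
apply: (lspan_map hl) Sa => _ [s ls ->].
by apply: lspan_mem; exists w, s, j.
Qed.

Lemma span_gam (a : Gam) : span a.
Proof.
case: a => [[f p] u].
have -> : (f, p, u) = (f, 0, 0) + ((0, p, 0) + (0, 0, u)) :> Gam.
  by congr (_, _, _); rewrite /= ?addr0 ?add0r.
by apply: lspanD (span_free f) _; apply: lspanD (span_evI p) (span_oddG u).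
Qed.

End Spanning.

(** * The universal property *)

(** Each word has a homogeneous value, so the subalgebra is graded. *)
Lemma span_normal_homogeneous (F : fieldType) (m n : nat) (K : superalg F)
    (t : 'I_m -> K) (v : 'I_n -> K) x :
  is_gamma_alg K -> (forall i, t i \in @sa_even F K) ->
  (forall j, v j \in @sa_odd F K) -> span_normal t v x ->
  exists y z, [/\ y \in @sa_even F K, z \in @sa_odd F K,
    span_normal t v y, span_normal t v z & x = y + z].
Proof.
move=> K_gamma t0 v1; have KS := ga_super K_gamma.
have [[K00 K0L] [K10 K1L]] := (sa_sub0 KS, sa_sub1 KS).
elim=> [|c _ y [[[w s] o] nx ->] _ [y0 [y1 [y0e y1o Sy0 Sy1 ->]]]].
  by exists 0, 0; rewrite addr0; split=> //; apply: lspan0.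
have Sx : image_on (@normal m n) (value t v) (value t v (w, s, o)).
  by exists (w, s, o).
have act_even h : h \in @sa_even F K -> act t w h \in @sa_even F K.
  by move=> h0; elim: w {nx Sx} => //= i w; apply: (sa_00 KS).
have act_odd h : h \in @sa_odd F K -> act t w h \in @sa_odd F K.
  by move=> h0; elim: w {nx Sx act_even} => //= i w; apply: (sa_01 KS).
have vv0 p : sa_mul (v p.1) (v p.2) \in @sa_even F K by apply: (sa_11 KS).
have pact_even h : h \in @sa_even F K -> pact v s h \in @sa_even F K.
  by move=> h0; elim: s {nx Sx} => //= p s; apply: (sa_00 KS).
have pact_odd h : h \in @sa_odd F K -> pact v s h \in @sa_odd F K.
  by move=> h0; elim: s {nx Sx pact_even} => //= p s; apply: (sa_01 KS).
case: o nx Sx => [j|] nx Sx.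
  exists y0, (c *: value t v (w, s, Some j) + y1); split=> //.
  - by apply: K1L => //; apply/act_odd/pact_odd/v1.
  - exact: lspanS.
  by rewrite addrCA.
exists (c *: value t v (w, s, None) + y0), y1; split=> //.
- by apply: K0L => //; apply/act_even/pact_even/(ga_one_even K_gamma).
- exact: lspanS.
by rewrite addrA.
Qed.

Section Universal.
Variables (F : fieldType) (m n : nat).
Local Notation Gam := (Gam F m n).
Variables (H : superalg F) (a : 'I_m -> H) (b : 'I_n -> H).
Hypothesis H_gamma : is_gamma_alg H.
Hypothesis a_even : forall i, a i \in @sa_even F H.
Hypothesis b_odd : forall j, b j \in @sa_odd F H.

Local Notation K := (prod_superalg Gam H).
Let t (i : 'I_m) : K := (gam_t F n i, a i).
Let v (j : 'I_n) : K := (gam_v F m j, b j).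
Local Notation graph := (span_normal t v).

Let K_gamma : is_gamma_alg K := prod_gamma (gam_gamma F m n) H_gamma.
Let t_even i : t i \in @sa_even F K.
Proof. by apply/andP; split; [apply: gam_t_even | apply: a_even]. Qed.
Let v_odd j : v j \in @sa_odd F K.
Proof. by apply/andP; split; [apply: gam_v_odd | apply: b_odd]. Qed.

Lemma value_pair x :
  value t v x = (value (@gam_t F m n) (@gam_v F m n) x, value a b x).
Proof.
rewrite [LHS]surjective_pairing; congr (_, _).
  exact: (hom_value _ _ _ (fst_hom Gam H)).
exact: (hom_value _ _ _ (snd_hom Gam H)).
Qed.

(** By independence of the normal words in [Gam], the graph is single-valued. *)
Lemma graph_eq0 x : graph (0, x) -> x = 0.
Proof.
rewrite /span_normal.
have -> : value t v = fun x => (value (@gam_t F m n) (@gam_v F m n) x, value a b x).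
  by apply/funext => y; apply: value_pair.
move=> g0; exact: (free_graph (@gvalue_free F m n) g0 erefl).
Qed.

Lemma graph_inj x y y' : graph (x, y) -> graph (x, y') -> y = y'.
Proof.
move=> gy gy'; apply/subr0_eq/graph_eq0.
have -> : (0, y - y') = (x, y) - (x, y') :> K by congr (_, _); rewrite /= subrr.
exact: lspanB.
Qed.

Lemma graph_total x : exists y, graph (x, y).
Proof.
have := span_gam x; elim=> [|c _ u [w nw ->] _ [y gy]].
  by exists 0; apply: lspan0.
exists (c *: value a b w + y).
have -> : (c *: value (@gam_t F m n) (@gam_v F m n) w + u, c *: value a b w + y)
  = c *: value t v w + (u, y) :> K by rewrite value_pair.
by apply: lspanS => //; exists w.
Qed.

(** The function with the given graph is compatible with all operations because
    the graph is a subalgebra. It preserves parity because the graph is graded: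
    if [x] is even, the odd component of [(x, f x)] has a zero first entry, hence
    vanishes. *)
Lemma gam_universal : exists f : Gam -> H,
  [/\ is_superalg_hom f, f \o @gam_t F m n =1 a, f \o @gam_v F m n =1 b
    & forall g : Gam -> H, is_superalg_hom g -> g \o @gam_t F m n =1 a ->
        g \o @gam_v F m n =1 b -> g =1 f].
Proof.
have Gam_super := ga_super (gam_gamma F m n).
have [[_ E0] [_ E1]] := (sa_sub0 Gam_super, sa_sub1 Gam_super).
have [f gf] := choice graph_total.
exists f; split.
- split.
  + move=> c x y; apply: graph_inj (gf _) _.
    have -> : (c *: x + y, c *: f x + f y) = c *: (x, f x) + (y, f y) :> K by [].
    by apply: lspanD; [apply: lspanZ (gf x) | apply: gf].
  + by apply: graph_inj (gf _) _; apply: (span_one K_gamma t_even v_odd).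
  + move=> x y; apply: graph_inj (gf _) _.
    exact: (span_normal_mul K_gamma t_even v_odd (gf x) (gf y)).
  + move=> x x0.
    have [[y0 z0] [[y1 z1] [/andP[/= y0e z0e] /andP[/= y1o z1o] _ Sz xE]]] :=
      span_normal_homogeneous K_gamma t_even v_odd (gf x).
    have y1_0 : y1 = 0.
      apply: (sa_disj Gam_super) y1o.
      have -> : y1 = - y0 + x by rewrite [x](congr1 fst xE) addKr.
      by rewrite -scaleN1r; apply: E0.
    rewrite y1_0 in Sz; have := congr1 snd xE => /= ->.
    by rewrite (graph_eq0 Sz) addr0.
  + move=> x x1.
    have [[y0 z0] [[y1 z1] [/andP[/= y0e z0e] /andP[/= y1o z1o] Sy _ xE]]] :=
      span_normal_homogeneous K_gamma t_even v_odd (gf x).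
    have y0_0 : y0 = 0.
      apply: (sa_disj Gam_super y0e).
      have -> : y0 = - y1 + x by rewrite [x](congr1 fst xE) addrC addrK.
      by rewrite -scaleN1r; apply: E1.
    rewrite y0_0 in Sy; have := congr1 snd xE => /= ->.
    by rewrite (graph_eq0 Sy) add0r.
- by move=> i; apply: graph_inj (gf _) _; apply: (span_even K_gamma t_even v_odd).
- by move=> j; apply: graph_inj (gf _) _; apply: (span_odd K_gamma t_even v_odd).
move=> g gh ga gb x.
have gl := sh_lin gh.
suff gE : forall z : K, graph z -> z.2 = g z.1 by exact/esym/(gE (x, f x)).
move=> z; elim=> [|c _ u [w nw ->] _ IH]; first by rewrite /= (linear_fun0 gl).
rewrite value_pair /= gl IH; congr (_ *: _ + _).
by rewrite (hom_value _ _ _ gh) (funext ga) (funext gb).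
Qed.

End Universal.

(** * The decomposition of [S_n V] *)

Section StandardBasis.
Variables (F : fieldType) (n : nat).

Definition basis_elt (x : seq ('I_n * 'I_n) * 'I_n) : An F n * An F n :=
  scal2 (amon F x.1) (vv F x.2).
Definition basis_idx (x : seq ('I_n * 'I_n) * 'I_n) : bool :=
  standard_word x.1 (Some x.2).
(** The basis element together with the family of its components; the span of
    these pairs is the graph of the decomposition ([basis_graphP]). *)
Definition basis_graph (x : seq ('I_n * 'I_n) * 'I_n) :=
  (basis_elt x, [ffun k => if k == x.2 then basis_elt x else 0]
   : {ffun 'I_n -> An F n * An F n}).

Lemma plucker_alpha (i j k l : 'I_n) : alpha F i j * alpha F k l =
  alpha F i l * alpha F k j - alpha F i k * alpha F l j.
Proof. by rewrite /alpha /det2 /=; ring. Qed.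

Lemma cyc_alpha (i j k : 'I_n) (c : An F n) :
  scal2 (alpha F i k * c) (vv F j)
  = scal2 (alpha F i j * c) (vv F k) - scal2 (alpha F k j * c) (vv F i).
Proof. by congr (_, _); rewrite /alpha /det2 /=; ring. Qed.

Lemma SnV_basis u : SnV u -> lspan (image_on basis_idx basis_elt) u.
Proof.
apply: lspan_trans => _ [a Sa [j ->]].
apply: (lspan_map (@scal2_linl F n (vv F j))) Sa => _ [s ls ->].
pose phi s o : An F n * An F n :=
  if o is Some k then scal2 (amon F s) (vv F k) else 0.
have phi_perm r r' o : perm_eq r r' -> phi r o = phi r' o.
  by case: o => [k|] // rr'; rewrite /phi /amon (perm_big _ rr').
apply: (lspan_trans _ (straighten phi_perm _ _ (Some j) ls)).
- by move=> _ [s' [[k|] [std_s' _ // _ ->]]]; apply: lspan_mem; exists (s', k).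
- move=> i k l h r [q|] _ _ _; last by rewrite /= subr0.
  rewrite /phi /amon !big_cons !mulrA plucker_alpha mulrBl.
  by congr (_, _); rewrite /= mulrBl.
move=> i k h r _ _; rewrite /phi /amon !big_cons.
exact: cyc_alpha.
Qed.

Lemma basis_free r (c : seq ('I_n * 'I_n) * 'I_n -> F) :
  uniq r -> all basis_idx r -> \sum_(x <- r) c x *: basis_elt x = 0 ->
  forall x, x \in r -> c x = 0.
Proof.
pose coef (x : seq ('I_n * 'I_n) * 'I_n) (u : An F n * An F n) : F^o :=
  u.2@_(lead x.1 (Some x.2)).
have coef_elt x y : coef x (basis_elt y)
    = (word_poly F y.1 (Some y.2))@_(lead x.1 (Some x.2)) by [].
apply: (triangular_free (lam := coef) (rho := fun x => lead x.1 (Some x.2))).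
- by move=> x a u w; rewrite /coef mcoeffD mcoeffZ.
- move=> [s j] /andP[/andP[ls _] _]; rewrite coef_elt.
  by have [_ ->] := mlead_word_poly F (Some j) ls; rewrite oner_neq0.
move=> [s j] [s' j'] std std'; rewrite coef_elt.
move=> /(@word_poly_triangular _ _ _ (Some j) _ (Some j') std std' erefl).
case=> [[ss' [jj']]|]; first by left; congr (_, _).
by right.
Qed.

Lemma BnV_basis j u :
  BnV j u -> lspan (image_on basis_idx basis_graph)
    (u, [ffun k => if k == j then u else 0]).
Proof.
have fl : linear (fun u : An F n * An F n =>
    (u, [ffun k => if k == j then u else 0] : {ffun 'I_n -> An F n * An F n})).
  move=> c u1 u2; congr (_, _); apply/ffunP => k; rewrite !ffunE.
  by case: eqP => // _; rewrite scaler0 addr0.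
apply: (lspan_map fl) => _ [_ [s std ->] ->].
by apply: lspan_mem; exists (s, j).
Qed.

Lemma basis_graphP u (w : {ffun 'I_n -> An F n * An F n}) :
  lspan (image_on basis_idx basis_graph) (u, w) <->
  (forall i, BnV i (w i)) /\ u = \sum_i w i.
Proof.
split=> [|[Bw ->]].
  pose P (z : (An F n * An F n) * {ffun 'I_n -> An F n * An F n}) :=
    (forall i, BnV i (z.2 i)) /\ z.1 = \sum_i z.2 i.
  suff : forall z, lspan (image_on basis_idx basis_graph) z -> P z.
    by move=> /(_ (u, w)).
  move=> z; elim=> [|c _ z' [[s j] std ->] _ [Bz z'E]].
    split=> [i|] /=; first by rewrite ffunE; apply: lspan0.
    by rewrite big1 // => i _; rewrite ffunE.
  split=> [i|] /=.
    rewrite !ffunE; case: eqP => [->|_]; last by rewrite scaler0 add0r.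
    apply: lspanS; last exact: Bz.
    by exists (amon F s) => //; exists s.
  rewrite [LHS]/(c *: basis_elt (s, j) + z'.1) z'E.
  under [RHS]eq_bigr do rewrite !ffunE.
  rewrite big_split /=; congr (_ + _).
  by rewrite (bigD1 j) //= eqxx big1 ?addr0 // => i /negPf->; rewrite scaler0.
have -> : (\sum_i w i, w) = \sum_i (w i, [ffun k => if k == i then w i else 0]
    : {ffun 'I_n -> An F n * An F n}).
  rewrite [RHS]surjective_pairing (raddf_sum fst) (raddf_sum snd) /=.
  congr (_, _); apply/ffunP => k; rewrite sum_ffunE (bigD1 k) //= ffunE eqxx.
  by rewrite big1 ?addr0 // => i /negPf ik; rewrite ffunE eq_sym ik.
by apply: lspan_sum => i; apply: BnV_basis.
Qed.

Lemma SnV_direct_sum : is_direct_sum (@BnV F n) (@SnV F n).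
Proof.
split=> [w Bw|u /SnV_basis Su].
  apply: lspan_sum => i.
  apply: lspan_trans (Bw i) => _ [_ [s /andP[/andP[ls _] _] ->] ->].
  apply: lspan_mem; exists (amon F s); last by exists i.
  by apply: lspan_mem; exists s.
have [w gw] : exists w, lspan (image_on basis_idx basis_graph) (u, w).
  elim: Su => [|c _ x [k std ->] _ [w gw]]; first by exists 0; apply: lspan0.
  exists (c *: (basis_graph k).2 + w).
  have -> : (c *: basis_elt k + x, c *: (basis_graph k).2 + w)
    = c *: basis_graph k + (x, w) by [].
  by apply: lspanS => //; exists k.
exists w; split=> [|w' /basis_graphP gw']; first exact/basis_graphP.
apply/eqP; rewrite -subr_eq0; apply/eqP.
have := free_graph basis_free (lspanB gw gw'); apply.
by rewrite /= subrr.
Qed.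

End StandardBasis.

Theorem theorem8 (F : fieldType) (m n : nat) :
  [/\ (* the algebra [Gam F m n] is free on the [t_i] and [v_j] *)
      is_free_gamma_alg (@gam_t F m n) (@gam_v F m n),
      (* [S_n V] is the direct sum of the [B_{n,j} V_j] *)
      is_direct_sum (@BnV F n) (@SnV F n),
      (* [v_i . v_j = alpha_ij] *)
      (forall i j : 'I_n,
         let p : gam_car F m n := sa_mul (gam_v F m i) (gam_v F m j) in
         [/\ p.1.1 = 0, evI_val p.1.2 = (alpha F i j)%:MP & p.2 = 0])
    & (* [f . u = u . f = f(tbar) u] *)
      (forall (f : freeT F m) (u : oddG F m n),
         let f' : Gam F m n := (f, 0, 0) in
         let u' : Gam F m n := (0, 0, u) in
         let p : gam_car F m n := sa_mul f' u' in
         let q : gam_car F m n := sa_mul u' f' in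
         [/\ p.1 = 0, oddG_val p.2 = scal2 (bar n f) (oddG_val u) & q = p])].
Proof.
split.
- split; [exact: gam_gamma | exact: gam_t_even | exact: gam_v_odd |].
  exact: gam_universal.
- exact: SnV_direct_sum.
- move=> i j p; have [p0 bp op] := pair_v F m i j; split=> //.
    move: bp; rewrite /even_bar -/p [X in bar n X]p0.
    by rewrite (linear_fun0 (@bar_linear F m n)) add0r.
  exact: val_inj.
move=> f u f' u' p q.
have f'0 : f' \in @sa_even F (Gam F m n) by exact: eqxx.
have u'1 : u' \in @sa_odd F (Gam F m n) by exact: eqxx.
split.
- by apply/eqP; apply: (sa_01 (ga_super (gam_gamma F m n)) f'0 u'1).
- have f'2 : oddG_val f'.2 = 0 by [].
  have f'E : even_bar f' = bar n f by rewrite /even_bar /= addr0.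
  by rewrite -f'E -[oddG_val u]/(oddG_val u'.2) -(odd_even_mul u' f'2).
exact/esym/(even_odd_comm (gam_gamma F m n) f'0 u'1).
Qed.
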